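(* Let $\{\xi_n\}_{n\ge1}$ be independent identically distributed real-valued random variables with distribution function $F$, with finite mean $\mathbf{E}\xi_1=-a<0$. Let $S_0=0$, $S_n=\sum_{i=1}^n\xi_i$ for $n\ge1$, and $M=\sup_{n\ge0}S_n$. Let $F^s$ be the second-tail distribution function of $F$, i.e. the distribution function on $\mathbb{R}$ with $1-F^s(x)=\overline{F^s}(x)=\min\bigl(1,\int_x^\infty (1-F(t))\,dt\bigr)$ for all $x\in\mathbb{R}$. (i) Suppose that $F^s$ is long-tailed. Then $$\liminf_{x\to\infty}\frac{\mathbf{P}(M>x)}{\overline{F^s}(x)}\ge\frac1a.$$ (ii) Suppose that $F^s$ is subexponential. Then $$\lim_{x\to\infty}\frac{\mathbf{P}(M>x)}{\overline{F^s}(x)}=\frac1a.$$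
   Context: For any distribution function $H$ on $\mathbb{R}$, write $\overline{H}(x)=1-H(x)$ for all $x$. A distribution function $H$ on $\mathbb{R}$ is long-tailed if $\lim_{x\to\infty}\overline{H}(x-h)/\overline{H}(x)=1$ for every fixed $h\in\mathbb{R}$ (this presupposes $\overline{H}(x)>0$ for all $x$). A distribution function $H$ on $\mathbb{R}_+=[0,\infty)$ is subexponential if and only if $\overline{H}(x)>0$ for all $x$ and $\lim_{x\to\infty}\overline{H^{*n}}(x)/\overline{H}(x)=n$ for all $n\ge2$, where $H^{*n}$ is the $n$-fold convolution of $H$ with itself. More generally, a distribution function $H$ on $\mathbb{R}$ is subexponential if and only if $H^+$ is subexponential, where $H^+=H\,\mathbf{I}_{\mathbb{R}_+}$ (so $H^+(x)=H(x)$ for $x\ge0$ and $H^+(x)=0$ for $x<0$) and $\mathbf{I}_{\mathbb{R}_+}$ is the indicator function of $\mathbb{R}_+$. *)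

(* Defs.v *)
From HB Require Import structures.
From mathcomp Require Export all_boot all_order all_algebra finmap.
From mathcomp Require Export all_classical all_reals all_analysis.

Set Implicit Arguments.
Unset Strict Implicit.
Unset Printing Implicit Defensive.

Import Order.TTheory GRing.Theory Num.Theory.
Import numFieldNormedType.Exports.

Local Open Scope classical_set_scope.
Local Open Scope ring_scope.

(* A distribution function on the line is an element of
   [cumulativeBounded 0 1]: nondecreasing, right-continuous, with limits
   0 at -oo and 1 at +oo. *)
Notation dist_fun R := (cumulativeBounded (0 : R) (1 : R)).

Definition tail (R : realType) (H : R -> R) (x : R) : R := 1 - H x.

Definition long_tailed (R : realType) (H : dist_fun R) : Prop :=
  (forall x, 0 < tail H x) /\
  forall h : R, tail H (x - h) / tail H x @[x --> +oo] --> (1 : R).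

Section positive_part.
Context {R : realType} (H : dist_fun R).

Definition pos_part (x : R) : R := if 0 <= x then H x else 0.

Let dist_fun_ge0 x : 0 <= H x.
Proof.
have /cvgrPdist_lt H0 := cumulativeNy H.
rewrite leNgt; apply/negP => Hx.
have [M [_ HM]] := H0 (- H x) ltac:(by rewrite oppr_gt0).
pose y := Num.min (M - 1) x.
have : `|0 - H y| < - H x by apply: HM; rewrite /y gt_min ltrBlDr ltrDl ltr01.
have Hyx : H y <= H x by apply: cumulative_is_nondecreasing; rewrite ge_min lexx orbT.
by rewrite sub0r normrN ler0_norm ?(le_trans Hyx (ltW Hx))// ltrN2 ltNge Hyx.
Qed.

Let pos_part_nd : nondecreasing pos_part.
Proof.
move=> x y xy; rewrite /pos_part.
case: ifPn => [x0|_]; last by case: ifPn.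
by rewrite (le_trans x0 xy); exact: cumulative_is_nondecreasing.
Qed.

Let pos_part_rc : right_continuous pos_part.
Proof.
move=> x; rewrite {2}/pos_part; case: ifPn => [x0|].
  apply: cvg_trans (cumulative_is_right_continuous H x).
  apply: near_eq_cvg; near=> y; rewrite /pos_part ifT//.
  by apply: (le_trans x0); apply: ltW; near: y; exact: nbhs_right_gt.
rewrite -ltNge => x0; apply: cvg_near_cst; near=> y; rewrite /pos_part ifF//.
apply/negbTE; rewrite -ltNge; near: y; exact: nbhs_right_lt.
Unshelve. all: by end_near. Qed.

Let pos_part_Ny0 : pos_part @ -oo --> (0 : R).
Proof.
apply: cvg_near_cst; near=> y; rewrite /pos_part ifF//.
by apply/negbTE; rewrite -ltNge; near: y; exact: nbhs_ninfty_lt.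
Unshelve. all: by end_near. Qed.

Let pos_part_y1 : pos_part @ +oo --> (1 : R).
Proof.
apply: cvg_trans (cumulativey H).
apply: near_eq_cvg; near=> y; rewrite /pos_part ifT//.
Unshelve. all: by end_near. Qed.

HB.instance Definition _ :=
  isCumulative.Build R _ R pos_part pos_part_nd pos_part_rc.
HB.instance Definition _ :=
  isCumulativeBounded.Build R 0 1 pos_part pos_part_Ny0 pos_part_y1.

End positive_part.

(* Distribution function of the sum of independent variables with
   distribution functions G and H. *)
Definition conv (R : realType) (G : R -> R) (H : dist_fun R) (x : R) : R :=
  \int[lebesgue_stieltjes_measure H]_y G (x - y).

(* H^{*1} = H and H^{*(n+1)} = H^{*n} * H; only meaningful for 1 <= n. *)
Definition conv_pow (R : realType) (H : dist_fun R) (n : nat) : R -> R :=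
  iter n.-1 (fun G => conv G H) H.

(* Intended for H vanishing on the negative half-line. *)
Definition subexponential_nonneg (R : realType) (H : dist_fun R) : Prop :=
  (forall x, 0 < tail H x) /\
  forall n : nat, (2 <= n)%N ->
    tail (conv_pow H n) x / tail H x @[x --> +oo] --> (n%:R : R).

Definition subexponential (R : realType) (H : dist_fun R) : Prop :=
  subexponential_nonneg (pos_part H : dist_fun R).

(* The minimum is taken in the extended reals, so that no convention is
   needed when the integral diverges. *)
Definition is_second_tail (R : realType) (F Fs : dist_fun R) : Prop :=
  forall x : R, (tail Fs x)%:E =
    mine 1%:E (\int[lebesgue_measure]_(t in `[x, +oo[) (tail F t)%:E)%E.

Definition mutually_independent (d : measure_display) (T : measurableType d)
    (R : realType) (P : probability T R) (X : nat -> {RV P >-> R}) : Prop :=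
  forall (J : {fset nat}) (B : nat -> set R),
    (forall i, measurable (B i)) ->
    P (\bigcap_(i in [set` J]) (X i @^-1` B i)) =
      (\prod_(i <- J) P (X i @^-1` B i))%E.

(* The n-th step of the walk is [xi n.-1]: indices are shifted by one. *)
Definition walk (d : measure_display) (T : measurableType d) (R : realType)
    (P : probability T R) (xi : nat -> {RV P >-> R}) (n : nat) (w : T) : R :=
  \sum_(i < n) xi i w.

Definition walk_sup (d : measure_display) (T : measurableType d)
    (R : realType) (P : probability T R) (xi : nat -> {RV P >-> R}) (w : T) :
    \bar R :=
  ereal_sup (range (fun n => (walk xi n w)%:E)).

(* Main.v *)
Require Import Defs.
From mathcomp Require Import measurable_realfun ring lra.

Set Implicit Arguments.
Unset Strict Implicit.
Unset Printing Implicit Defensive.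

Import Order.TTheory GRing.Theory Num.Theory.
Import numFieldNormedType.Exports.

Local Open Scope classical_set_scope.
Local Open Scope ring_scope.

(** The proof follows the principle of one big jump.  Write M_N for the maximum
    of the first N partial sums and b for the tail 1 - F of the step.  Since
    M_(N+1) has the law of max(0, xi + M_N) with xi and M_N independent,
    P(M_N > x) is the function [max_tail] obtained from the indicator of x < 0
    by iterating x |-> E P(M_N > x - xi) on x >= 0 ([walk_max_tail]).  From
    there on only this recursion is used, also for the walks with steps xi + c
    and - xi - c, whose maxima control the fluctuations around the drift.

    A walk with negative mean drift has an almost surely finite maximum
    ([negative_drift_max_tail_cvg0]).  Since E M_N increases with N,
    0 <= E max(xi, - M_N), so M_N cannot tend to infinity in probability
    ([walk_max_tail_lt1]); a passage over a high level, repeated, then turns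
    a probability of escape smaller than one into zero ([max_tail_vanish]).

    Lower bound ([max_tail_lower], [tail_lower_bound]): fix c > a.  With
    probability close to one the walk stays above the line - L - n c for ever.
    While it is above the line and has not yet passed x, a step larger than
    x + L + n c makes it pass x, so P(M > x) is at least nearly the sum over n
    of b (x + L + n c), which is about 1/c times the integrated tail at x + L,
    that is, the tail of [Fs] for large x; long-tailedness removes L, and c tends to a.

    Upper bound ([max_tail_crossing], [tail_upper_bound]): fix c < a and look at
    the first passage of the walk over the line L - n c.  It happens with a
    probability gamma that is small when L is large.  To be above x, the walk
    either jumps at this moment over x - A, which costs at most about 1/c times
    the integrated tail, or restarts below x - A and must still climb.  If
    P(M > u) <= C * tail u for u >= A, the second case costs at most
    (gamma + delta) * C * tail x, because subexponentiality makes the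
    contribution of two moderately large jumps negligible ([mid_conv_small]).
    Hence an asymptotic bound with constant C improves to one with constant
    1/c + delta + (gamma + delta) * C; iterating from an a priori bound and
    letting gamma, delta tend to 0 and c to a gives the constant 1/a. *)

(** * Expectations of bounded functions *)

Section bounded_functions.
Context d (T : measurableType d) (R : realType) (P : probability T R).
Implicit Types f g : T -> R.

Definition bounded_measurable f :=
  measurable_fun setT f /\ exists M : R, forall w, `|f w| <= M.

Lemma bmeas_integrable f : bounded_measurable f -> P.-integrable setT (EFin \o f).
Proof.
move=> [mf [M Mf]]; apply: measurable_bounded_integrable => //.
  by rewrite -ge0_fin_numE// fin_num_measure.
exists M; split; rewrite ?num_real// => y My w _ /=.
exact: le_trans (Mf w) (ltW My).
Qed.

Lemma bmeas_cst c : bounded_measurable (fun=> c).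
Proof. by split; [exact: measurable_cst|exists `|c|]. Qed.

Lemma bmeasD f g : bounded_measurable f -> bounded_measurable g ->
  bounded_measurable (fun w => f w + g w).
Proof.
move=> [mf [M Mf]] [mg [N Ng]]; split; first exact: measurable_funD.
by exists (M + N) => w; rewrite (le_trans (ler_normD _ _))// lerD.
Qed.

Lemma bmeasZ c f : bounded_measurable f -> bounded_measurable (fun w => c * f w).
Proof.
move=> [mf [M Mf]]; split; first exact: measurable_funM.
by exists (`|c| * M) => w; rewrite normrM ler_wpM2l.
Qed.

Lemma bmeas_int_cst c : \int[P]_w c = c.
Proof.
rewrite Rintegral_cst// (_ : fine _ = 1) ?mulr1//.
by rewrite -[RHS]/(fine 1%:E); congr fine; exact: probability_setT.
Qed.

Lemma bmeas_intD f g : bounded_measurable f -> bounded_measurable g ->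
  \int[P]_w (f w + g w) = \int[P]_w f w + \int[P]_w g w.
Proof. by move=> bf bg; rewrite RintegralD//; exact: bmeas_integrable. Qed.

Lemma bmeas_intZ c f : bounded_measurable f -> \int[P]_w (c * f w) = c * \int[P]_w f w.
Proof. by move=> bf; rewrite RintegralZl//; exact: bmeas_integrable. Qed.

Lemma bmeas_le f g : bounded_measurable f -> bounded_measurable g -> (forall w, f w <= g w) ->
  \int[P]_w f w <= \int[P]_w g w.
Proof.
by move=> bf bg fg; apply: le_Rintegral => //; exact: bmeas_integrable.
Qed.

Lemma bmeas_nonincreasing (q : R -> R) (h : T -> R) (M : R) :
  measurable_fun setT h -> (forall x y, x <= y -> q y <= q x) ->
  (forall x, 0 <= q x <= M) -> bounded_measurable (fun w => q (h w)).
Proof.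
move=> mh qm qb; split.
  apply: (measurableT_comp _ mh); apply: nonincreasing_measurable => //.
by exists M => w; have /andP[q0 qM] := qb (h w); rewrite ger0_norm.
Qed.

Lemma bmeas_nondecreasing (q : R -> R) (h : T -> R) (M : R) :
  measurable_fun setT h -> (forall x y, x <= y -> q x <= q y) ->
  (forall x, 0 <= q x <= M) -> bounded_measurable (fun w => q (h w)).
Proof.
move=> mh qm qb; split.
  apply: (measurableT_comp _ mh); apply: nondecreasing_measurable => //.
by exists M => w; have /andP[q0 qM] := qb (h w); rewrite ger0_norm.
Qed.

Lemma bmeas_indic_gt (X : T -> R) (t : R) : measurable_fun setT X ->
  bounded_measurable (fun w => (t < X w)%R%:R).
Proof.
move=> mX; apply: (@bmeas_nondecreasing (fun x => (t < x)%R%:R) X 1) => //.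
- by move=> x y xy; rewrite ler_nat; case: ltP => //= /lt_le_trans ->.
- by move=> x; rewrite ler0n lern1 leq_b1.
Qed.

Lemma measurable_gt (X : T -> R) (t : R) : measurable_fun setT X ->
  measurable [set w | t < X w].
Proof.
move=> mX; have := mX measurableT `]t, +oo[%classic (measurable_itv _).
rewrite setTI; congr measurable; apply/seteqP; split=> w /=;
  by rewrite in_itv/= andbT.
Qed.

Lemma int_indic_gt (X : T -> R) (t : R) : measurable_fun setT X ->
  \int[P]_w (t < X w)%R%:R = fine (P [set w | t < X w]).
Proof.
move=> mX; rewrite /Rintegral; congr fine.
rewrite -(setIT [set w | t < X w]) -integral_indic//; last exact: measurable_gt.
apply: eq_integral => w _; rewrite indicE; congr ((nat_of_bool _)%:R%:E).
by apply/idP/idP => [?|]; rewrite ?inE.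
Qed.

End bounded_functions.

(** * The tail of the maximum of a random walk *)

Section max_tail.
Context d (T : measurableType d) (R : realType) (P : probability T R).

(** P(M_N > x), computed from the law of a single step X; see
    [walk_max_tail]. *)
Fixpoint max_tail (X : T -> R) (N : nat) (x : R) : R :=
  if x < 0 then 1 else
  if N is N'.+1 then \int[P]_w max_tail X N' (x - X w) else 0.

Variable X : T -> R.
Hypothesis mX : measurable_fun setT X.

Lemma max_tail_neg N x : x < 0 -> max_tail X N x = 1.
Proof. by case: N => [|N] /= ->. Qed.

Lemma max_tail0 x : 0 <= x -> max_tail X 0 x = 0.
Proof. by move=> x0; rewrite /= ltNge x0. Qed.

Lemma max_tailS N x : 0 <= x ->
  max_tail X N.+1 x = \int[P]_w max_tail X N (x - X w).
Proof. by move=> x0; rewrite /= ltNge x0. Qed.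

Lemma max_tail_facts N :
  (forall x, 0 <= max_tail X N x <= 1) /\
  (forall x y, x <= y -> max_tail X N y <= max_tail X N x).
Proof.
elim: N => [|N [N01 Nmon]].
  split=> [x|x y xy] /=; first by case: ifP; rewrite ?ler01 lexx.
  by case: (ltP y) => y0; case: (ltP x) => x0 //; move: (le_lt_trans xy y0);
    rewrite ltNge x0.
have mshift x : measurable_fun setT (fun w => x - X w).
  by apply: measurable_funB => //; exact: measurable_cst.
have bm x : bounded_measurable (fun w => max_tail X N (x - X w)).
  by apply: (@bmeas_nonincreasing _ _ _ _ (fun w => x - X w) 1).
have N01' x : 0 <= max_tail X N.+1 x <= 1.
  have [x0|x0] := ltP x 0; first by rewrite max_tail_neg// ler01 lexx.
  rewrite max_tailS//; apply/andP; split.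
    by apply: Rintegral_ge0 => w _; have /andP[] := N01 (x - X w).
  rewrite -[leRHS](bmeas_int_cst P); apply: bmeas_le => //.
    exact: bmeas_cst.
  by move=> w; have /andP[] := N01 (x - X w).
split=> // x y xy; have [x0|x0] := ltP x 0.
  by rewrite (max_tail_neg _ x0); have /andP[] := N01' y.
rewrite !max_tailS ?(le_trans x0 xy)//; apply: bmeas_le => // w.
by apply: Nmon; rewrite lerB.
Qed.

Lemma max_tail_ge0 N x : 0 <= max_tail X N x.
Proof. by have [/(_ x)/andP[]] := max_tail_facts N. Qed.

Lemma max_tail_le1 N x : max_tail X N x <= 1.
Proof. by have [/(_ x)/andP[]] := max_tail_facts N. Qed.

Lemma max_tail_nonincr N x y : x <= y -> max_tail X N y <= max_tail X N x.
Proof. by have [_] := max_tail_facts N; exact. Qed.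

Lemma bmeas_max_tail N (h : T -> R) :
  measurable_fun setT h -> bounded_measurable (fun w => max_tail X N (h w)).
Proof.
move=> mh; have [N01 Nmon] := max_tail_facts N.
by apply: (@bmeas_nonincreasing _ _ _ _ h 1).
Qed.

Lemma max_tail_le N N' x : (N <= N')%N -> max_tail X N x <= max_tail X N' x.
Proof.
have mshift y : measurable_fun setT (fun w => y - X w).
  by apply: measurable_funB => //; exact: measurable_cst.
elim: N N' x => [|N IH] [|N'] // x NN'; have [x0|x0] := ltP x 0;
  rewrite ?(max_tail_neg _ x0)//.
  by apply: le_trans (max_tail_ge0 N'.+1 x); rewrite /= ltNge x0.
by rewrite !max_tailS//; apply: bmeas_le => [||w];
  [exact: bmeas_max_tail..|exact: IH].
Qed.

End max_tail.

Section one_big_jump.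
Context d (T : measurableType d) (R : realType) (P : probability T R).
Variable X : T -> R.
Hypothesis mX : measurable_fun setT X.

Let mXD (c : R) : measurable_fun setT (fun w => X w + c).
Proof. by apply: measurable_funD => //; exact: measurable_cst. Qed.

Let mDX (c : R) : measurable_fun setT (fun w => c + X w).
Proof. by apply: measurable_funD => //; exact: measurable_cst. Qed.

Let mBX (c : R) : measurable_fun setT (fun w => c - X w).
Proof. by apply: measurable_funB => //; exact: measurable_cst. Qed.

(** First passage over the line b - k c.  Started at s below the line, the walk
    can exceed x only after passing the line.  At the passage to a point t the
    remaining probability is at most [G t + K]: the part [K] is paid with the
    probability that the line is ever passed, which is a maximum tail of the
    walk with steps X + c, and [G] is bounded at step k by its value for a jump
    starting on the line, because [G] is nondecreasing. *)
Lemma max_tail_crossing (N : nat) (x c K B : R) (G : R -> R) :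
  0 <= c -> 0 <= K ->
  (forall t, 0 <= G t <= B) -> (forall s t, s <= t -> G s <= G t) ->
  (forall t, max_tail P X N (x - t) <= G t + K) ->
  forall m, (m <= N.+1)%N -> forall b s, s <= b -> b <= x ->
  max_tail P X m (x - s) <=
    \sum_(k < m) \int[P]_w G (b - k%:R * c + X w) +
    K * max_tail P (fun w => X w + c) m (b - s).
Proof.
move=> c0 K0 G0B Gmon GK.
have bG t : bounded_measurable (fun w => G (t + X w)).
  by apply: (@bmeas_nondecreasing _ _ _ _ (fun w => t + X w) B).
elim=> [|m IH] mN b s sb bx.
  rewrite big_ord0 add0r max_tail0 ?subr_ge0 ?(le_trans sb bx)//.
  by rewrite mulr_ge0// max_tail_ge0.
rewrite max_tailS ?subr_ge0 ?(le_trans sb bx)//.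
rewrite (@max_tailS _ _ _ _ (fun w => X w + c)) ?subr_ge0//.
rewrite big_ord_recl mul0r subr0.
pose S := \sum_(k < m) \int[P]_w G (b - c - k%:R * c + X w).
have S0 : 0 <= S.
  by apply: sumr_ge0 => k _; apply: Rintegral_ge0 => w _; case/andP: (G0B (b - c - k%:R * c + X w)).
rewrite (_ : \sum_(k < m) _ = S); last first.
  apply: eq_bigr => k _; apply: eq_Rintegral => w _; congr (G (_ + _)).
  by rewrite lift0 -natr1; ring.
have bY : bounded_measurable (fun w => max_tail P (fun w => X w + c) m (b - s - (X w + c))).
  apply: bmeas_max_tail => //; apply: measurable_funB => //; exact: mXD.
rewrite -(bmeas_intZ P K bY) -{1}(bmeas_int_cst P S).
rewrite -(bmeas_intD P (bG b) (bmeas_cst T S)) -bmeas_intD//; last 2 first.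
  by apply: bmeasD => //; exact: bmeas_cst.
  exact: bmeasZ.
apply: bmeas_le.
- exact: bmeas_max_tail.
- by apply: bmeasD; [apply: bmeasD => //; exact: bmeas_cst|exact: bmeasZ].
move=> w; have G0 : 0 <= G (b + X w) by case/andP: (G0B (b + X w)).
have [cross|nocross] := ltP (b - c) (s + X w).
  rewrite (@max_tail_neg _ _ _ _ (fun w => X w + c)) ?mulr1; last by lra.
  have -> : x - s - X w = x - (s + X w) by ring.
  have le1 : max_tail P X m (x - (s + X w)) <= G (s + X w) + K.
    by apply: (le_trans _ (GK _)); exact: max_tail_le.
  have le2 : G (s + X w) <= G (b + X w) by apply: Gmon; rewrite lerD2r.
  lra.
have := IH (ltnW mN) (b - c) (s + X w) nocross.
rewrite -/S; have -> : x - (s + X w) = x - s - X w by ring.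
have -> : b - c - (s + X w) = b - s - (X w + c) by ring.
move=> /(_ ltac:(lra)) IHm; lra.
Qed.

(** The first factor is a lower bound, by the union bound, for the probability
    that the walk started at s stays between the line l - k c and x; as long as
    it does, a jump larger than x - l + k c at step k leads above x.  When s is
    outside this strip one of the two subtracted probabilities is 1 and the
    left-hand side is nonpositive. *)
Lemma max_tail_lower (x c : R) : forall N l s,
  (1 - max_tail P X N (x - s) - max_tail P (fun w => - X w - c) N (s - l)) *
  \sum_(k < N) fine (P [set w | x - l + k%:R * c < X w])
  <= max_tail P X N (x - s).
Proof.
have mY : measurable_fun setT (fun w => - X w - c).
  by apply: measurable_funB => //; exact: measurableT_comp.
elim=> [|N IH] l s; first by rewrite big_ord0 mulr0 max_tail_ge0.
set u := max_tail P X N.+1 (x - s).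
set r := max_tail P (fun w => - X w - c) N.+1 (s - l).
have u0 : 0 <= u by exact: max_tail_ge0.
have r0 : 0 <= r by exact: max_tail_ge0.
have dead : 1 - u - r <= 0 -> (1 - u - r) *
    \sum_(k < N.+1) fine (P [set w | x - l + k%:R * c < X w]) <= u.
  move=> h; apply: (le_trans _ u0); apply: mulr_le0_ge0 => //.
  by apply: sumr_ge0 => k _; exact: fine_ge0.
have [xs|sx] := ltP x s.
  by apply: dead; rewrite {1}/u max_tail_neg ?subr_lt0//; lra.
have [sl|ls] := ltP s l.
  by apply: dead; rewrite {1}/r (@max_tail_neg _ _ _ _ (fun w => - X w - c)) ?subr_lt0//; lra.
rewrite big_ord_recl mul0r addr0.
pose S := \sum_(k < N) fine (P [set w | x - (l - c) + k%:R * c < X w]).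
rewrite (_ : \sum_(k < N) _ = S); last first.
  apply: eq_bigr => k _; rewrite lift0 -natr1.
  by have -> : x - l + (k%:R + 1) * c = x - (l - c) + k%:R * c by ring.
have S0 : 0 <= S by apply: sumr_ge0 => k _; exact: fine_ge0.
have bu : bounded_measurable (fun w => max_tail P X N (x - s - X w)) by exact: bmeas_max_tail.
have br : bounded_measurable (fun w => max_tail P (fun w => - X w - c) N (s - l - (- X w - c))).
  by apply: bmeas_max_tail => //; exact: measurable_funB.
have bi : bounded_measurable (fun w => (x - l < X w)%R%:R : R) by exact: bmeas_indic_gt.
have uE : u = \int[P]_w max_tail P X N (x - s - X w).
  by rewrite /u max_tailS// subr_ge0.
have rE : r = \int[P]_w max_tail P (fun w => - X w - c) N (s - l - (- X w - c)).
  by rewrite /r (@max_tailS _ _ _ _ (fun w => - X w - c)) ?subr_ge0.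
(* After a jump larger than x - l the walk is above x, so that v = 1 and the
   induction hypothesis only contributes a nonpositive term. *)
have step : fine (P [set w | x - l < X w]) + S <= u + (S * u + S * r).
  rewrite -(int_indic_gt P (x - l) mX) -{1}(bmeas_int_cst P S) uE rE.
  rewrite -!(bmeas_intZ P S)// -!bmeas_intD//; first last;
    try by [exact: bmeas_cst | exact: bmeasZ | apply: bmeasD; exact: bmeasZ].
  apply: bmeas_le => [||w].
  - by apply: bmeasD => //; exact: bmeas_cst.
  - by apply: bmeasD => //; apply: bmeasD; exact: bmeasZ.
  have := IH (l - c) (s + X w); rewrite -/S.
  have -> : x - (s + X w) = x - s - X w by ring.
  have -> : s + X w - (l - c) = s - l - (- X w - c) by ring.
  set v := max_tail P X N _; set t := max_tail P _ N _ => IHw.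
  have t0 : 0 <= t by exact: max_tail_ge0.
  have [jump|_] /= := ltP (x - l) (X w); last by lra.
  have -> : v = 1 by rewrite /v max_tail_neg//; lra.
  have := mulr_ge0 S0 t0; lra.
have F1 : fine (P [set w | x - l < X w]) <= 1.
  rewrite -[leRHS]/(fine 1%:E) fine_le ?fin_num_measure//.
    exact: measurable_gt.
  by apply: probability_le1; exact: measurable_gt.
have F0 : 0 <= fine (P [set w | x - l < X w]) by exact: fine_ge0.
have := mulr_ge0 F0 (addr_ge0 u0 r0); lra.
Qed.

End one_big_jump.

(** * Stop-loss transform and finiteness of the maximum *)

(** The orbit of [C0] under C |-> kappa + theta * C converges to the fixed point
    kappa / (1 - theta), so an improvable bound can be improved up to it. *)
Lemma affine_iteration (R : realType) (Pr : R -> Prop) (kappa theta C0 : R) :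
  0 <= kappa -> 0 <= theta < 1 -> 0 <= C0 -> Pr C0 ->
  (forall C C', C <= C' -> Pr C -> Pr C') ->
  (forall C, 0 <= C -> Pr C -> Pr (kappa + theta * C)) ->
  forall eta, 0 < eta -> Pr (kappa / (1 - theta) + eta).
Proof.
move=> k0 /andP[t0 t1] C00 PC0 Pmon Pstep eta eta0.
pose C n := iter n (fun C => kappa + theta * C) C0.
have CP n : 0 <= C n /\ Pr (C n).
  elim: n => [//|n [IH1 IH2]]; split; last exact: Pstep.
  by rewrite /= addr_ge0// mulr_ge0.
pose Cs := kappa / (1 - theta).
have CsE : Cs = kappa + theta * Cs.
  by rewrite /Cs; field; rewrite subr_eq0 gt_eqF.
have CE n : C n = Cs + theta ^+ n * (C0 - Cs).
  elim: n => [|n IH]; first by rewrite expr0 /C /=; ring.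
  by rewrite [LHS]/= -/(C n) IH exprS mulrDr addrA -CsE mulrA.
have : (fun n => theta ^+ n * (C0 - Cs)) @ \oo --> (0 * (C0 - Cs) : R).
  by apply: cvgMl; apply: cvg_expr; rewrite ger0_norm.
rewrite mul0r => /cvgrPdist_le/(_ _ eta0)[n _ /(_ n (leqnn _))/=].
rewrite sub0r normrN => hn; apply: (Pmon (C n)); last exact: (CP n).2.
by rewrite CE -/Cs lerD2l (le_trans (ler_norm _)).
Qed.

Section integrable_step.
Context d (T : measurableType d) (R : realType) (P : probability T R).
Variable X : T -> R.
Hypothesis iX : P.-integrable setT (EFin \o X).

Lemma integrable_mfun : measurable_fun setT X.
Proof. by have /integrableP[/measurable_EFinP] := iX. Qed.

Lemma integrable_affine (f : T -> R) (a b : R) :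
  measurable_fun setT f -> (forall w, `|f w| <= a * `|X w| + b) ->
  P.-integrable setT (EFin \o f).
Proof.
move=> mf fab.
have ig : P.-integrable setT (EFin \o (fun w => a * `|X w| + b)).
  apply: (@integrableD _ _ _ P setT measurableT (fun w => (a * `|X w|)%:E) (cst b%:E)) => //.
    apply: (@integrableZl _ _ _ P setT measurableT a (fun w => `|X w|%:E)).
    exact: integrable_norm.
  exact: finite_measure_integrable_cst.
apply: le_integrable ig => //; first exact/measurable_EFinP.
move=> w _; rewrite lee_fin; apply: le_trans (fab w) _; exact: ler_norm.
Qed.

Let mpos (t : R) : measurable_fun setT (fun w => Num.max 0 (X w - t)).
Proof.
apply: measurable_maxr; first exact: measurable_cst.
by apply: measurable_funB; [exact: integrable_mfun|exact: measurable_cst].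
Qed.

Let ipos (t : R) : P.-integrable setT (EFin \o (fun w => Num.max 0 (X w - t))).
Proof.
apply: (@integrable_affine _ 1 `|t|) => // w.
have hX := ler_norm (X w); have ht := ler_norm (- t); rewrite normrN in ht.
have hX0 := normr_ge0 (X w); have ht0 := normr_ge0 t.
by rewrite maxEle; case: ifPn => h; rewrite ger0_norm//; lra.
Qed.

(** Dominated convergence along the integers, with dominating function |X|. *)
Lemma stop_loss_cvg0 (eps : R) : 0 < eps ->
  exists t, forall s, t <= s -> \int[P]_w Num.max 0 (X w - s) <= eps.
Proof.
move=> e0.
have mf n : measurable_fun setT (fun w => (Num.max 0 (X w - n%:R))%:E).
  exact/measurable_EFinP.
have cv0 : {ae P, forall w, setT w ->
    (Num.max 0 (X w - n%:R))%:E @[n --> \oo] --> cst 0%E w}.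
  apply: aeW => w _; apply: cvg_near_cst; near=> n; congr EFin.
  by apply: max_idPl; rewrite subr_le0; near: n; exact: nbhs_infty_ger.
have dom : {ae P, forall w n, setT w ->
    (`|(Num.max 0 (X w - n%:R))%:E| <= `|X w|%:E)%E}.
  apply: aeW => w n _; rewrite lee_fin.
  have hX := ler_norm (X w); have n0 : 0 <= n%:R :> R by [].
  have hX0 := normr_ge0 (X w).
  by rewrite maxEle; case: ifPn => h; rewrite ger0_norm//; lra.
have [_ _] := dominated_convergence measurableT mf (measurable_cst _) cv0
  (integrable_norm iX) dom.
rewrite integral0 => cv.
move/fine_cvg : cv => /cvgrPdist_le/(_ _ e0)[n _ /(_ n (leqnn _))/=].
rewrite sub0r normrN => hn; exists n%:R => s ns.
apply: le_trans (le_trans (ler_norm _) hn).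
apply: le_Rintegral => // w _; rewrite !maxEle.
by case: ifPn => h1; case: ifPn => h2; lra.
Unshelve. all: by end_near. Qed.

(** Pointwise, the number of k >= 0 with t + k c < X is at most (X - t + c)^+ / c. *)
Lemma sum_tail_le_stop_loss (c : R) : 0 < c -> forall N t,
  \sum_(k < N) \int[P]_w (t + k%:R * c < X w)%R%:R <=
  c^-1 * \int[P]_w Num.max 0 (X w - (t - c)).
Proof.
move=> c0; elim=> [|N IH] t.
  rewrite big_ord0 mulr_ge0 ?invr_ge0 ?(ltW c0)//.
  by apply: Rintegral_ge0 => w _; rewrite le_max lexx.
rewrite big_ord_recl mul0r addr0.
have {}IH := IH (t + c); rewrite addrK in IH.
have mX := integrable_mfun.
have ii : P.-integrable setT (EFin \o (fun w => (t < X w)%R%:R : R)).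
  exact/bmeas_integrable/bmeas_indic_gt.
apply: (@le_trans _ _ (\int[P]_w (t < X w)%R%:R + c^-1 * \int[P]_w Num.max 0 (X w - t))).
  rewrite lerD2l; apply: le_trans IH; apply: ler_sum => k _.
  rewrite lift0 -natr1.
  by have -> : t + (k%:R + 1) * c = t + c + k%:R * c by ring.
have iZ s : P.-integrable setT (EFin \o (fun w => c^-1 * Num.max 0 (X w - s))).
  exact: (@integrableZl _ _ _ P setT measurableT c^-1 (fun w => (Num.max 0 (X w - s))%:E) (ipos s)).
rewrite -!RintegralZl// -RintegralD//; apply: le_Rintegral => //.
  exact: (@integrableD _ _ _ P setT measurableT (fun w => ((t < X w)%R%:R)%:E) (fun w => (c^-1 * Num.max 0 (X w - t))%:E) ii (iZ t)).
move=> w _; rewrite -(ler_pM2l c0) mulrDr !mulrA divff ?gt_eqF// !mul1r.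
by rewrite !maxEle; case: (ltP t (X w)) => h1; case: ifPn => h2; case: ifPn => h3 /=; lra.
Qed.

(** With G the indicator of t > x - A and K a bound for the tail at A,
    [max_tail_crossing] shows that a bound C for the tail at some level yields the
    bound eps + rho * C at a higher level, whatever eps > 0; here rho < 1 bounds
    the probability of passing the line. *)
Lemma max_tail_vanish (c L rho : R) : 0 < c -> 0 <= L -> rho < 1 ->
  (forall N, max_tail P (fun w => X w + c) N L <= rho) ->
  forall eta, 0 < eta -> exists A, forall N, max_tail P X N A <= eta.
Proof.
move=> c0 L0 rho1 hrho eta eta0.
have mX := integrable_mfun.
have mXc : measurable_fun setT (fun w => X w + c).
  by apply: measurable_funD => //; exact: measurable_cst.
have rho0 : 0 <= rho by apply: le_trans (hrho 0%N); exact: max_tail_ge0.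
have e0 : 0 < eta / 2 * (1 - rho) by rewrite mulr_gt0 ?subr_gt0// divr_gt0.
have -> : eta = (eta / 2 * (1 - rho)) / (1 - rho) + eta / 2.
  by field; rewrite subr_eq0 gt_eqF.
apply: (@affine_iteration _ (fun C => exists A, forall N, max_tail P X N A <= C)
    _ _ 1) => //.
- exact: ltW.
- by rewrite rho0.
- by exists 0 => N; exact: max_tail_le1.
- by move=> C C' CC' [A hA]; exists A => N; exact: le_trans (hA N) CC'.
- move=> C C0 [A hA].
  have [t ht] := stop_loss_cvg0 (mulr_gt0 c0 e0).
  pose x := Num.max L (t + A + L + c).
  have Lx : L <= x by rewrite /x le_max lexx.
  have tx : t + A + L + c <= x by rewrite /x le_max lexx orbT.
  exists x => N; apply: le_trans (max_tail_le P mX x (leqnSn N)) _.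
  rewrite -{1}(subr0 x).
  apply: le_trans (@max_tail_crossing _ _ _ P _ mX N x c C 1
    (fun t => (x - A < t)%R%:R) (ltW c0) C0 _ _ _ N.+1 (leqnn _) L 0 L0 Lx) _.
  + by move=> s; rewrite ler0n lern1 leq_b1.
  + by move=> s1 s2 s12; rewrite ler_nat; case: (ltP (x - A) s1) => //= /lt_le_trans ->.
  + move=> s; have [_|h] := ltP (x - A) s; first by rewrite (le_trans (max_tail_le1 _ mX _ _))// lerDl.
    by rewrite add0r; apply: le_trans (hA N); apply: max_tail_nonincr => //; lra.
  + rewrite subr0 (mulrC rho); apply: lerD; last by rewrite ler_wpM2l.
    rewrite (eq_bigr (fun k : 'I_N.+1 => \int[P]_w (x - A - L + k%:R * c < X w)%R%:R)); last first.
      move=> k _; apply: eq_Rintegral => w _; congr ((nat_of_bool _)%:R).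
      by apply/idP/idP => h; lra.
    apply: le_trans (sum_tail_le_stop_loss c0 _ _) _.
    rewrite ler_pdivrMl//; apply: ht; lra.
- by rewrite divr_gt0.
Qed.

End integrable_step.

(** * Independence and the law of the maximum *)

(** Rectangles form a pi-system generating the product sigma-algebra. *)
Lemma measure_eq_rectangles d1 d2 (T1 : measurableType d1)
    (T2 : measurableType d2) (R : realType)
    (m1 m2 : {measure set (T1 * T2) -> \bar R}) :
  (m1 setT < +oo)%E ->
  (forall A B, measurable A -> measurable B -> m1 (A `*` B) = m2 (A `*` B)) ->
  forall D, measurable D -> m1 D = m2 D.
Proof.
move=> m1oo m12 D mD.
pose C : set (set (T1 * T2)) :=
  [set C | exists A, measurable A /\ exists B, measurable B /\ C = A `*` B].
apply: (measure_unique C (fun=> setT)) => //.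
- rewrite measurable_prod_measurableType //; congr (<<s _ >>).
  rewrite predeqE; split => [[A mA [B mB <-]]|[A [mA [B [mB ->]]]]].
    by exists A; split => //; exists B.
  by exists A => //; exists B.
- move=> _ _ [A1 [mA1 [A2 [mA2 ->]]]] [B1 [mB1 [B2 [mB2 ->]]]].
  rewrite -setXI; exists (A1 `&` B1); split; first exact: measurableI.
  by exists (A2 `&` B2); split => //; exact: measurableI.
- by move=> _; exists setT; split => //; exists setT; split => //; rewrite setXTT.
- by rewrite bigcup_const//; exists 0%N.
- by move=> _ [A [mA [B [mB ->]]]]; exact: m12.
Qed.

(** Packs the push-forward along a function that carries no bundled proof of
    measurability. *)
Lemma image_measure d1 d2 (T1 : measurableType d1) (T2 : measurableType d2)
    (R : realType) (m : {measure set T1 -> \bar R}) (f : T1 -> T2) :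
  measurable_fun setT f ->
  {m' : {measure set T2 -> \bar R} | forall A, m' A = m (f @^-1` A)}.
Proof.
move=> mf; unshelve refine (exist _ (pushforward m f : {measure set T2 -> \bar R}) _).
  exact: mf.
by [].
Qed.

Section iid_maximum.
Context d (T : measurableType d) (R : realType) (P : probability T R).
Variable xi : nat -> {RV P >-> R}.
Hypothesis hindep : mutually_independent xi.
Hypothesis hident : forall n (B : set R), measurable B ->
  P (xi n @^-1` B) = P (xi 0%N @^-1` B).
Variable f : R -> R.
Hypothesis mf : measurable_fun setT f.

(** The maximum over n <= N of the sums of f (xi i), k <= i < k + n (see
    [walk_max_gt]), computed from its first step on, so that it depends on
    [xi k] and on a maximum that is independent of [xi k]. *)
Fixpoint walk_max (k N : nat) (w : T) : R :=
  if N is N'.+1 then Num.max 0 (f (xi k w) + walk_max k.+1 N' w) else 0.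

Lemma measurable_walk_max k N : measurable_fun setT (walk_max k N).
Proof.
elim: N k => [|N IH] k /=; first exact: measurable_cst.
apply: measurable_maxr; first exact: measurable_cst.
by apply: measurable_funD => //; apply: measurableT_comp.
Qed.

Let mpre k N (C : set R) : measurable C -> measurable (walk_max k N @^-1` C).
Proof.
by move=> mC; rewrite -[X in measurable X]setTI; exact: measurable_walk_max.
Qed.

Let mxi n (C : set R) : measurable C -> measurable (xi n @^-1` C).
Proof.
move=> mC; rewrite -[X in measurable X]setTI.
exact: (measurable_funPT (xi n)).
Qed.

Let past k (B : nat -> set R) := \bigcap_(i < k) (xi i @^-1` B i).

Let mpast k B : (forall i, measurable (B i)) -> measurable (past k B).
Proof. by move=> mB; apply: bigcap_measurableType => i _; exact: mxi. Qed.

Let past_prod k B : (forall i, measurable (B i)) ->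
  P (past k B) = (\prod_(i < k) P (xi i @^-1` B i))%E.
Proof.
move=> mB; have := hindep [fset i in iota 0 k]%fset mB.
rewrite (_ : \bigcap_(i in _) _ = past k B); last first.
  by apply: eq_bigcapl; split=> i /=; rewrite !inE/= mem_iota add0n.
move=> ->; rewrite (perm_big (iota 0 k)) /=.
  by rewrite -[X in iota 0 X]subn0 big_mkord.
apply: uniq_perm; [exact: fset_uniq|exact: iota_uniq|].
by move=> i; rewrite !inE.
Qed.

Let pastS k B : (forall i, measurable (B i)) ->
  P (past k.+1 B) = (P (past k B) * P (xi k @^-1` B k))%E.
Proof. by move=> mB; rewrite !past_prod// big_ord_recr. Qed.

Let mZ k N : measurable_fun setT (fun w => (xi k w, walk_max k.+1 N w)).
Proof. by apply/measurable_fun_pair => //; exact: measurable_walk_max. Qed.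

(** The product rule for rectangles extends to one more step: both sides of the
    equality, as functions of the event for the pair formed by [xi k] and the
    maximum from k + 1 on, are finite measures that agree on rectangles. *)
Lemma walk_max_indep N k (B : nat -> set R) (C : set R) :
  (forall i, measurable (B i)) -> measurable C ->
  P (past k B `&` walk_max k N @^-1` C) =
  (P (past k B) * P (walk_max k N @^-1` C))%E.
Proof.
elim: N k B C => [|N IH] k B C mB mC.
  have [C0|C0] := pselect (C 0).
    rewrite (_ : walk_max k 0 @^-1` C = setT); last by apply/seteqP; split.
    by rewrite setIT probability_setT mule1.
  rewrite (_ : walk_max k 0 @^-1` C = set0); last by apply/seteqP; split.
  by rewrite setI0 measure0 mule0.
have mE := mpast k mB.
have upd (A : set R) (D : nat -> set R) : measurable A ->
    (forall i, measurable (D i)) ->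
    (forall i, measurable ((fun i => if i == k then A else D i) i)).
  by move=> mA mD i; case: ifP.
have updE (A : set R) (D : nat -> set R) :
    past k.+1 (fun i => if i == k then A else D i) = past k D `&` xi k @^-1` A.
  rewrite /past !bigcap_mkord big_ord_recr /= eqxx; congr (_ `&` _).
  by apply: eq_bigr => i _; rewrite ltn_eqF.
have updP (A : set R) (D : nat -> set R) : measurable A ->
    (forall i, measurable (D i)) ->
    P (past k D `&` xi k @^-1` A) = (P (past k D) * P (xi k @^-1` A))%E.
  move=> mA mD; rewrite -updE pastS; last exact: upd.
  rewrite eqxx; congr (P _ * _)%E.
  by apply: eq_bigcapr => i /= ik; rewrite ltn_eqF.
have past_setT : past k (fun=> setT) = setT.
  by apply/seteqP; split => // w _ i _.
pose Z (w : T) : R * R := (xi k w, walk_max k.+1 N w).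
have mZN : measurable_fun setT Z by exact: mZ.
have PE0 := fine_ge0 (measure_ge0 P (past k B)).
have PEE : P (past k B) = (fine (P (past k B)))%:E by rewrite fineK ?fin_num_measure.
have rect A D : measurable A -> measurable D ->
    P (Z @^-1` (A `*` D) `&` past k B) =
    (P (past k B) * P (Z @^-1` (A `*` D)))%E.
  move=> mA mD.
  have ZE : Z @^-1` (A `*` D) = xi k @^-1` A `&` walk_max k.+1 N @^-1` D.
    by apply/seteqP; split.
  have := IH k.+1 (fun i => if i == k then A else setT) D (upd _ _ mA (fun=> measurableT)) mD.
  have := IH k.+1 (fun i => if i == k then A else B i) D (upd _ _ mA mB) mD.
  rewrite !updE past_setT setTI -ZE updP// => indB ->.
  by rewrite muleA -indB ZE; congr (P _); rewrite setIC setIA.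
have [m1 m1E] := image_measure (mrestr P mE) mZN.
have [m2 m2E] := image_measure (mscale (NngNum PE0) P) mZN.
have meq D : measurable D -> m1 D = m2 D.
  apply: measure_eq_rectangles => [|A C' mA mC'].
    rewrite m1E; apply: (@le_lt_trans _ _ 1%E); last by rewrite ltry.
    rewrite preimage_setT; apply: probability_le1.
    exact: measurableI.
  rewrite m1E m2E; apply: (eq_trans (rect _ _ mA mC')).
  by rewrite {1}PEE.
have mD : measurable ((fun z : R * R => Num.max 0 (f z.1 + z.2)) @^-1` C).
  rewrite -[X in measurable X]setTI.
  suff : measurable_fun setT (fun z : R * R => Num.max 0 (f z.1 + z.2)) by exact.
  apply: measurable_maxr; first exact: measurable_cst.
  by apply: measurable_funD; [exact: (measurableT_comp mf)|exact: measurable_snd].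
have := meq _ mD; rewrite m1E m2E => h.
by rewrite setIC PEE; exact: h.
Qed.

(** The maximum from time k on is max(0, f (xi k) + Y) with Y independent of
    [xi k], so the law of the pair is a product and Tonelli gives the recursion
    of [max_tail]. *)
Lemma walk_max_tail N k (x : R) :
  fine (P [set w | x < walk_max k N w]) = max_tail P (f \o xi 0%N) N x.
Proof.
have mgt (t : R) : measurable [set y : R | t < y].
  have := measurable_itv `]t, +oo[; congr measurable.
  by apply/seteqP; split=> y /=; rewrite in_itv/= andbT.
elim: N k x => [|N IH] k x /=.
  case: ifPn => x0; last by rewrite (_ : [set _ | _] = set0) ?measure0//; apply/seteqP; split.
  rewrite (_ : [set _ | _] = setT); last by apply/seteqP; split.
  by rewrite -[RHS]/(fine 1%:E) probability_setT.
have [x0|x0] := ltP x 0.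
  rewrite (_ : [set _ | _] = setT); last first.
    by apply/seteqP; split => // w _ /=; rewrite lt_max x0.
  by rewrite -[RHS]/(fine 1%:E) probability_setT.
pose Y : {mfun T >-> R} := mfun_Sub (mem_set (measurable_walk_max k.+1 N)).
pose D := [set z : R * R | x < f z.1 + z.2].
have mD : measurable D.
  have mg : measurable_fun setT (fun z : R * R => f z.1 + z.2).
    by apply: measurable_funD; [exact: (measurableT_comp mf)|exact: measurable_snd].
  by have := mg measurableT _ (mgt x); rewrite setTI.
have [joint jointE] := image_measure P (mZ k N).
have indep A C : measurable A -> measurable C ->
    joint (A `*` C) = (distribution P (xi k) A * distribution P Y C)%E.
  move=> mA mC; rewrite jointE.
  have mB i : measurable ((fun i => if i == k then A else setT) i).
    by case: ifP.
  have := walk_max_indep N k.+1 mB mC.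
  rewrite pastS// eqxx.
  have -> : past k (fun i => if i == k then A else setT) = setT.
    by apply/seteqP; split => // w _ i /= ik; rewrite ltn_eqF.
  rewrite probability_setT mul1e => <-; congr (P _).
  rewrite /past bigcap_mkord big_ord_recr /= eqxx big1 ?setTI//.
  by move=> i _; rewrite ltn_eqF.
have -> : P [set w | x < Num.max 0 (f (xi k w) + walk_max k.+1 N w)] = joint D.
  rewrite jointE; congr (P _); apply/seteqP; split=> w /=;
    by rewrite lt_max ltNge x0.
rewrite -(product_measure_unique indep mD).
have tailE (y : R) : distribution P Y (xsection D y) = (max_tail P (f \o xi 0%N) N (x - f y))%:E.
  rewrite -(IH k.+1) fineK ?fin_num_measure//; last first.
    by have := mpre k.+1 N (mgt (x - f y)).
  congr (P _); apply/seteqP; split=> w /=; by rewrite /xsection /= in_setE /D /= ltrBlDl.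
have mm : measurable_fun setT (fun y : R => (max_tail P (f \o xi 0%N) N (x - f y))%:E).
  apply/measurable_EFinP.
  have mh : measurable_fun setT (fun y : R => x - f y) by apply: measurable_funB.
  apply: (measurableT_comp _ mh); apply: nonincreasing_measurable => // a b.
  by apply: max_tail_nonincr; exact: measurableT_comp.
rewrite /product_measure1 /= (eq_integral _ _ (fun y _ => tailE y)).
rewrite (eq_measure_integral (distribution P (xi 0%N))); last first.
  by move=> A mA _; exact: hident.
rewrite ge0_integral_distribution//= => y; rewrite lee_fin.
by apply: max_tail_ge0; exact: measurableT_comp.
Qed.

Lemma walk_max_gt N k (x : R) w :
  x < walk_max k N w <-> exists2 n, (n <= N)%N & x < \sum_(i < n) f (xi (k + i)%N w).
Proof.
elim: N k x => [|N IH] k x /=.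
  split=> [x0|[n]]; first by exists 0%N; rewrite ?big_ord0.
  by rewrite leqn0 => /eqP ->; rewrite big_ord0.
rewrite lt_max; split.
- case/orP => [x0|]; first by exists 0%N; rewrite ?big_ord0.
  rewrite -ltrBlDl => /IH[n nN h]; exists n.+1 => //.
  rewrite big_ord_recl addn0 -ltrBlDl.
  by under eq_bigr do rewrite lift0 addnS -addSn.
- case=> [[|n]] nN; first by rewrite big_ord0 => ->.
  rewrite big_ord_recl addn0 -ltrBlDl => h; apply/orP; right.
  rewrite -ltrBlDl; apply/IH; exists n => //; move: h.
  by under eq_bigr do rewrite lift0 addnS -addSn.
Qed.

Lemma walk_max_ge0 k N w : 0 <= walk_max k N w.
Proof. by case: N => [|N] //=; rewrite le_max lexx. Qed.

Lemma walk_max_homo k N w : walk_max k N w <= walk_max k N.+1 w.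
Proof.
rewrite leNgt; apply/negP => /walk_max_gt[n nN].
by move=> h; have : walk_max k N.+1 w < walk_max k N.+1 w;
  [apply/walk_max_gt; exists n => //; exact: leqW|rewrite ltxx].
Qed.

End iid_maximum.

(** * A walk with negative drift does not escape *)

(** Open right half-lines form a pi-system generating the Borel sets. *)
Lemma probability_eq_tails (R : realType) (m1 m2 : probability R R) :
  (forall x : R, m1 `]x, +oo[%classic = m2 `]x, +oo[%classic) ->
  forall A, measurable A -> m1 A = m2 A.
Proof.
move=> m12 A mA.
apply: (measure_unique (@RGenOInfty.G R) (fun n : nat => `](- n%:R : R), +oo[%classic)) => //.
- exact: RGenOInfty.measurableE.
- move=> _ _ [x ->] [y ->]; exists (Num.max x y).
  by apply/seteqP; split=> z /=; rewrite !in_itv/= !andbT gt_max => /andP.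
- by move=> n; exists (- n%:R).
- apply/seteqP; split => // x _.
  have [n _ /(_ n (leqnn n)) /= hn] := nbhs_infty_gtr (- x).
  by exists n => //=; rewrite in_itv/= andbT ltrNl.
- by move=> _ [x ->]; exact: m12.
- by move=> k; apply: le_lt_trans (ltry 1); apply: probability_le1.
Qed.

Section negative_drift.
Context d (T : measurableType d) (R : realType) (P : probability T R).
Variable xi : nat -> {RV P >-> R}.
Hypothesis hindep : mutually_independent xi.
Hypothesis hident : forall n (B : set R), measurable B ->
  P (xi n @^-1` B) = P (xi 0%N @^-1` B).
Variable f : R -> R.
Hypothesis mf : measurable_fun setT f.
Hypothesis intf : P.-integrable setT (EFin \o (f \o xi 0%N)).

Let mfxi k : measurable_fun setT (f \o xi k).
Proof. exact: measurableT_comp. Qed.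

Let ifxi k : P.-integrable setT (EFin \o (f \o xi k)).
Proof.
apply/integrableP; split; first exact/measurable_EFinP.
have /integrableP[_] := intf.
have mg : measurable_fun setT (fun y : R => `|(f y)%:E|%E).
  by apply: measurableT_comp => //; exact/measurable_EFinP.
rewrite -(ge0_integral_distribution (xi 0%N) mg) //.
rewrite -(ge0_integral_distribution (xi k) mg) //.
suff -> : (\int[distribution P (xi k)]_y `|(f y)%:E| =
  \int[distribution P (xi 0%N)]_y `|(f y)%:E|)%E by [].
by apply: eq_measure_integral => A mA _; exact: hident.
Qed.

Let mwalk k N : measurable_fun setT (walk_max xi f k N).
Proof. exact: measurable_walk_max. Qed.

Let iwalk k N : P.-integrable setT (EFin \o walk_max xi f k N).
Proof.
elim: N k => [|N IH] k; first exact: integrable0.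
apply: (@le_integrable _ _ _ _ _ _ _
  ((EFin \o (f \o xi k)) \+ (EFin \o walk_max xi f k.+1 N))%E) => //.
- exact/measurable_EFinP.
- move=> w _; rewrite lee_fin ger0_norm ?walk_max_ge0//=.
  rewrite ge_max normr_ge0 /=; exact: ler_norm.
- exact: integrableD.
Qed.

Let walk_shift N : \int[P]_w walk_max xi f 1 N w = \int[P]_w walk_max xi f 0 N w.
Proof.
pose Y k : {mfun T >-> R} := mfun_Sub (mem_set (mwalk k N)).
have Yd : forall A, measurable A -> distribution P (Y 1%N) A = distribution P (Y 0%N) A.
  apply: probability_eq_tails => x.
  have YE k : distribution P (Y k) `]x, +oo[%classic = P [set w | x < walk_max xi f k N w].
    by congr (P _); apply/seteqP; split=> w /=; rewrite in_itv/= andbT.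
  have mgt k : measurable [set w | x < walk_max xi f k N w].
    exact: measurable_gt.
  apply: (eq_trans (YE 1%N)); apply: (eq_trans _ (esym (YE 0%N))).
  rewrite -[LHS]fineK ?fin_num_measure// -[RHS]fineK ?fin_num_measure//.
  by rewrite !walk_max_tail.
rewrite /Rintegral; congr fine.
(* The truncation makes the integrand nonnegative on the whole line. *)
pose g (y : R) := (Num.max 0 y)%:E.
have mg : measurable_fun setT g.
  by apply/measurable_EFinP; apply: measurable_maxr => //; exact: measurable_cst.
have g0 y : (0 <= g y)%E by rewrite lee_fin le_max lexx.
have gE k : (\int[P]_w (walk_max xi f k N w)%:E = \int[P]_w (g \o Y k) w)%E.
  apply: eq_integral => w _; congr EFin; apply/esym/max_idPr.
  exact: walk_max_ge0.
rewrite !gE -!ge0_integral_distribution//.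
by apply: eq_measure_integral => A mA _; exact: Yd.
Qed.

(** Let Y0 be the maximum over N + 1 steps and Y1 the maximum over the N steps
    that follow the first one.  E Y0 >= E Y1 because Y1 has the law of the
    maximum over the first N steps, while Y0 - Y1 = max(X, - Y1) is at most
    X + (- X - m)^+ + m * 1_(Y1 <= m).  For m so large that
    E (- X - m)^+ <= eta := - E X / 2, this forces P(Y1 <= m) >= eta / m for
    every N. *)
Lemma walk_max_tail_lt1 : \int[P]_w f (xi 0%N w) < 0 ->
  exists m rho, [/\ 0 <= m, rho < 1 &
    forall N, max_tail P (f \o xi 0%N) N m <= rho].
Proof.
set mean := \int[P]_w _ => mean0.
have iNX : P.-integrable setT (EFin \o (fun w => - f (xi 0%N w))).
  exact: (integrableN intf).
pose eta := - mean / 2.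
have eta0 : 0 < eta by rewrite /eta; lra.
have [t ht] := stop_loss_cvg0 iNX eta0.
pose m := Num.max 1 t.
have m1 : 1 <= m by rewrite /m le_max lexx.
have m0 : 0 < m by apply: lt_le_trans m1.
exists m, (1 - eta / m); split; first exact: ltW.
  by rewrite gtrBl divr_gt0.
move=> N; rewrite -(@walk_max_tail _ _ _ _ xi hindep hident f mf N 1 m).
set Y0 := walk_max xi f 0 N.+1; set Y1 := walk_max xi f 1 N.
have iY0 : P.-integrable setT (EFin \o Y0) by exact: iwalk.
have iY1 : P.-integrable setT (EFin \o Y1) by exact: iwalk.
have mY1 : measurable_fun setT Y1 by exact: mwalk.
have mono : 0 <= \int[P]_w Y0 w - \int[P]_w Y1 w.
  rewrite subr_ge0 /Y1 walk_shift; apply: le_Rintegral => //.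
  by move=> w _; exact: walk_max_homo.
rewrite -RintegralB// in mono.
have bI : bounded_measurable (fun w => (m < Y1 w)%R%:R : R) by exact: bmeas_indic_gt.
have bI' : bounded_measurable (fun w => m * (1 + -1 * (m < Y1 w)%R%:R)).
  by apply: bmeasZ; apply: bmeasD; [exact: bmeas_cst|exact: bmeasZ].
have ishort : P.-integrable setT
    (EFin \o (fun w => Num.max 0 (- f (xi 0%N w) - m))).
  apply: (@integrable_affine _ _ _ _ (fun w => f (xi 0%N w)) intf _ 1 `|m|).
    apply: measurable_maxr; first exact: measurable_cst.
    apply: measurable_funB; last exact: measurable_cst.
    by apply: measurableT_comp => //; exact: (mfxi 0%N).
  move=> w; have hX := ler_norm (- f (xi 0%N w)); rewrite normrN in hX.
  have ht' := ler_norm m; have h0 := normr_ge0 (f (xi 0%N w)).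
  by rewrite maxEle; case: ifPn => h; rewrite ger0_norm//; lra.
have iX := intf.
have step : \int[P]_w (Y0 w - Y1 w) <=
  mean + \int[P]_w Num.max 0 (- f (xi 0%N w) - m) +
    m * (1 - \int[P]_w (m < Y1 w)%R%:R).
  have -> : m * (1 - \int[P]_w (m < Y1 w)%R%:R) =
      \int[P]_w (m * (1 + -1 * (m < Y1 w)%R%:R)).
    rewrite bmeas_intZ; last first.
      by apply: bmeasD; [exact: bmeas_cst|exact: bmeasZ].
    rewrite bmeas_intD; [|exact: bmeas_cst|exact: bmeasZ].
    by rewrite bmeas_int_cst bmeas_intZ// mulN1r.
  have i1 : P.-integrable setT (EFin \o
      (fun w => f (xi 0%N w) + Num.max 0 (- f (xi 0%N w) - m))).
    exact: (integrableD measurableT iX ishort).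
  have i2 := bmeas_integrable P bI'.
  rewrite -RintegralD// -RintegralD//.
  apply: le_Rintegral => //.
  - exact: (integrableB measurableT iY0 iY1).
  - exact: (integrableD measurableT i1 i2).
  move=> w _; rewrite /Y0 /= -/(Y1 w).
  have := walk_max_ge0 xi f 1 N w; rewrite -/(Y1 w) => Y10.
  by rewrite !maxEle; case: (ltP m (Y1 w)) => h1; case: ifPn => h2;
    case: ifPn => h3 /=; lra.
have short : \int[P]_w Num.max 0 (- f (xi 0%N w) - m) <= eta.
  by apply: ht; rewrite /m le_max lexx orbT.
have tailE : \int[P]_w (m < Y1 w)%R%:R = fine (P [set w | m < Y1 w]).
  exact: int_indic_gt.
rewrite -tailE -(ler_pM2l m0) mulrBr (mulrC m (eta / m)) divfK ?gt_eqF//.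
rewrite /eta in short *; lra.
Qed.

End negative_drift.

(** * Distribution tails and the integrated tail *)

Section dist_fun_tail.
Context (R : realType) (H : dist_fun R).

Lemma tail_nonincr x y : x <= y -> tail H y <= tail H x.
Proof. by move=> xy; rewrite lerD2l lerN2 cumulative_is_nondecreasing. Qed.

Lemma tail_cvg0 : tail H x @[x --> +oo] --> 0.
Proof.
have : 1 - H x @[x --> +oo] --> (1 - 1 : R).
  by apply: cvgB; [exact: cvg_cst|exact: cumulativey].
by rewrite subrr.
Qed.

Lemma tail_ge0 x : 0 <= tail H x.
Proof.
apply: (cvgr_to_le tail_cvg0).
near=> y; apply: tail_nonincr; near: y; apply: nbhs_pinfty_ge; exact: num_real.
Unshelve. all: by end_near. Qed.

Lemma tail_le1 x : tail H x <= 1.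
Proof.
have cv : 1 - H y @[y --> -oo] --> (1 - 0 : R).
  by apply: cvgB; [exact: cvg_cst|exact: cumulativeNy].
rewrite subr0 in cv.
apply: (cvgr_to_ge cv).
near=> y; apply: tail_nonincr; near: y; apply: nbhs_ninfty_le; exact: num_real.
Unshelve. all: by end_near. Qed.

End dist_fun_tail.

Section integrated_tail.
Context (R : realType) (F Fs : dist_fun R).
Hypothesis hFs : is_second_tail F Fs.

Let I (x : R) := (\int[lebesgue_measure]_(t in `[x, +oo[) (tail F t)%:E)%E.

Let mtail (A : set R) : measurable_fun A (fun t => (tail F t)%:E).
Proof.
apply/measurable_EFinP; apply: (@measurable_funS _ _ _ _ setT) => //.
apply: nonincreasing_measurable => // x y; exact: tail_nonincr.
Qed.

Let I_split x c : 0 <= c ->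
  I x = ((\int[lebesgue_measure]_(t in `[x, (x + c)%R[) (tail F t)%:E) + I (x + c)%R)%E.
Proof.
move=> c0; have U : `[x, +oo[%classic =
    `[x, (x + c)%R[%classic `|` `[(x + c)%R, +oo[%classic.
  by rewrite -itv_bndbnd_setU// bnd_simp lerDl.
rewrite /I {1}U ge0_integral_setU//=.
- exact: mtail.
- by move=> t _; rewrite lee_fin tail_ge0.
- apply/disj_setPS => t [] /=; rewrite !in_itv/= andbT => /andP[_ h1] h2.
  by move: (lt_le_trans h1 h2); rewrite ltxx.
Qed.

Let itv_measure (x c : R) : 0 <= c ->
  lebesgue_measure `[x, (x + c)[%classic = c%:E.
Proof.
move=> c0; rewrite lebesgue_measure_itv/= lte_fin ltrDl.
have [_|c0'] := ltP 0 c; first by rewrite -EFinD; congr EFin; ring.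
by congr EFin; apply/eqP; rewrite eq_le c0 c0'.
Qed.

Let piece_ge x c : 0 <= c ->
  ((c * tail F (x + c))%R%:E <=
   \int[lebesgue_measure]_(t in `[x, (x + c)%R[) (tail F t)%:E)%E.
Proof.
move=> c0; rewrite mulrC EFinM -(itv_measure x c0) -integral_cst//=.
apply: ge0_le_integral => //=.
- by move=> t _; rewrite lee_fin tail_ge0.
- exact: mtail.
- move=> t; rewrite in_itv/= => /andP[_ /ltW h]; rewrite lee_fin.
  exact: tail_nonincr.
Qed.

Let piece_le x c : 0 <= c ->
  (\int[lebesgue_measure]_(t in `[x, (x + c)%R[) (tail F t)%:E <=
   (c * tail F x)%R%:E)%E.
Proof.
move=> c0; rewrite mulrC EFinM -(itv_measure x c0) -integral_cst//=.
apply: ge0_le_integral => //=.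
- by move=> t _; rewrite lee_fin tail_ge0.
- exact: mtail.
- move=> t; rewrite in_itv/= => /andP[h _]; rewrite lee_fin.
  exact: tail_nonincr.
Qed.

Let I_ge0 x : (0 <= I x)%E.
Proof. by apply: integral_ge0 => t _; rewrite lee_fin tail_ge0. Qed.

Let I_eventually : exists x1, forall x, x1 <= x -> I x = (tail Fs x)%:E.
Proof.
have /cvgrPdist_lt/(_ _ ltr01)[x1 [_ h]] := @tail_cvg0 _ Fs.
exists (x1 + 1) => x x1x.
have x1x' : x1 < x by apply: lt_le_trans x1x; rewrite ltrDl.
have := h x x1x'; rewrite /= sub0r normrN ger0_norm ?tail_ge0// => t1.
have := hFs x; rewrite -/(I x) /Order.min; case: ifP => // _ [tE].
by move: t1; rewrite tE ltxx.
Qed.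

Let I_fin x : I x \is a fin_num.
Proof.
have [x1 h] := I_eventually.
have [xx1|x1x] := leP x x1; last by rewrite h// ltW.
have c0 : 0 <= x1 - x by rewrite subr_ge0.
have hx := I_split x c0; rewrite subrKC (h x1)// in hx.
rewrite ge0_fin_numE// hx; apply: (@le_lt_trans _ _ (((x1 - x) * tail F x + tail Fs x1)%R%:E)); last exact: ltry.
by rewrite [leRHS]EFinD; apply: leeD2r; have := piece_le x c0; rewrite subrKC.
Qed.

(** J is the integral of the tail of F from x to infinity.  It is finite
    everywhere because it coincides with the tail of [Fs], which is smaller than
    1, far to the right. *)
Lemma integrated_tail : exists J : R -> R, [/\
  (forall x c, 0 <= c ->
    c * tail F (x + c) + J (x + c) <= J x <= c * tail F x + J (x + c)),
  (forall x, 0 <= J x),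
  (forall x y, x <= y -> J y <= J x) &
  exists x1, forall x, x1 <= x -> J x = tail Fs x].
Proof.
exists (fun x => fine (I x)).
have step x c : 0 <= c ->
    c * tail F (x + c) + fine (I (x + c)) <= fine (I x) <=
    c * tail F x + fine (I (x + c)).
  move=> c0; have := I_split x c0; have := piece_ge x c0; have := piece_le x c0.
  set p := (\int[lebesgue_measure]_(t in _) _)%E => le1 le2 IE.
  have pf : p \is a fin_num.
    rewrite ge0_fin_numE; first exact: le_lt_trans le1 (ltry _).
    by apply: integral_ge0 => t _; rewrite lee_fin tail_ge0.
  rewrite IE (fineD pf (I_fin (x + c))); move: le1 le2; rewrite -{1 2}(fineK pf) !lee_fin => le1 le2.
  by apply/andP; split; rewrite lerD2r.
split=> //.
- by move=> x; apply: fine_ge0; exact: I_ge0.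
- move=> x y xy; have := step x (y - x); rewrite subr_ge0 xy subrKC.
  move=> /(_ isT)/andP[+ _]; apply: le_trans; rewrite lerDr.
  by apply: mulr_ge0; [rewrite subr_ge0|exact: tail_ge0].
- have [x1 h] := I_eventually; exists x1 => x x1x.
  by rewrite h.
Qed.

End integrated_tail.

Section tail_sums.
(* J stands for the integrated tail of F; see [integrated_tail]. *)
Context (R : realType) (F : dist_fun R) (J : R -> R).
Hypothesis Jstep : forall x c, 0 <= c ->
  c * tail F (x + c) + J (x + c) <= J x <= c * tail F x + J (x + c).
Hypothesis J0 : forall x, 0 <= J x.

Lemma sum_tail_le_integral (c : R) : 0 <= c -> forall N x,
  c * \sum_(k < N) tail F (x + k%:R * c) <= J (x - c).
Proof.
move=> c0; elim=> [|N IH] x; first by rewrite big_ord0 mulr0.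
rewrite big_ord_recl mul0r addr0 mulrDr.
have /andP[+ _] := Jstep (x - c) c0; rewrite subrK; apply: le_trans.
rewrite lerD2l; have := IH (x + c); rewrite addrK; apply: le_trans.
rewrite le_eqVlt; apply/orP; left; apply/eqP; congr (_ * _).
by apply: eq_bigr => k _; congr (tail F _); rewrite lift0 -natr1; ring.
Qed.

Lemma integral_le_sum_tail (c : R) : 0 <= c -> forall N x,
  J x <= c * \sum_(k < N) tail F (x + k%:R * c) + J (x + N%:R * c).
Proof.
move=> c0; elim=> [|N IH] x; first by rewrite big_ord0 mulr0 add0r mul0r addr0.
rewrite big_ord_recl mul0r addr0 mulrDr -addrA.
have /andP[_ h] := Jstep x c0; apply: (le_trans h); rewrite lerD2l.
apply: (le_trans (IH (x + c))).
have -> : x + c + N%:R * c = x + N.+1%:R * c by rewrite -natr1; ring.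
rewrite lerD2r le_eqVlt; apply/orP; left; apply/eqP; congr (_ * _).
by apply: eq_bigr => k _; congr (tail F _); rewrite lift0 -natr1; ring.
Qed.

End tail_sums.

(** * Convolution square of a subexponential distribution *)

Section subexponential_estimates.
Context (R : realType) (H : dist_fun R).
Hypothesis H_neg : forall x, x < 0 -> H x = 0.
Hypothesis tail_gt0 : forall x, 0 < tail H x.

Local Notation lam := (lebesgue_stieltjes_measure H).

Lemma stieltjes_tail (t : R) : fine (lam [set z | t < z]) = tail H t.
Proof.
have -> : [set z | t < z] = ~` `]-oo, t]%classic.
  by apply/seteqP; split=> z /=; rewrite in_itv/= ltNge => /negP.
rewrite probability_setC// fineB//; last by rewrite fin_num_measure.
by have := cdf_lebesgue_stieltjes_id H t; rewrite /cdf /distribution /pushforward /= preimage_id => ->.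
Qed.

(** H vanishes on the negative half-line, but H 0 may be positive: the half-line
    has to be exhausted by closed half-lines away from 0. *)
Lemma stieltjes_neg : lam [set z : R | z < 0] = 0%E.
Proof.
have -> : [set z : R | z < 0] = \bigcup_n `]-oo, (- n.+1%:R^-1)]%classic.
  apply/seteqP; split=> z /=.
    move=> z0; have /ltr_add_invr[k hk] : z < 0 by [].
    by exists k => //=; rewrite in_itv/= ltW// -[ltRHS]sub0r ltrBrDr.
  case=> n _; rewrite /= in_itv/= => /le_lt_trans; apply.
  by rewrite oppr_lt0 invr_gt0.
apply/(negligibleP lam).
  by apply: bigcup_measurable => n _; exact: measurable_itv.
apply: negligible_bigcup => n; apply/negligibleP; first exact: measurable_itv.
have := cdf_lebesgue_stieltjes_id H (- n.+1%:R^-1).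
rewrite /cdf /distribution /pushforward /= preimage_id => ->.
by rewrite H_neg// oppr_lt0 invr_gt0.
Qed.

Lemma bmeas_tail_shift x : bounded_measurable (fun z : R => tail H (x - z)).
Proof.
apply: (@bmeas_nondecreasing _ _ _ (fun z => tail H (x - z)) idfun 1) => //; first exact: measurable_id.
- by move=> s t st; apply: tail_nonincr; rewrite lerB.
- by move=> z; rewrite tail_ge0 tail_le1.
Qed.

(** Probability that Y + Z > x for independent Y, Z of law H, conditioned on Z. *)
Lemma conv_tail x : tail (conv H H) x = \int[lam]_z tail H (x - z).
Proof.
have bH : bounded_measurable (fun z : R => H (x - z)).
  apply: (@bmeas_nonincreasing _ _ _ (fun z => H (x - z)) idfun 1) => //; first exact: measurable_id.
  - by move=> s t st; apply: cumulative_is_nondecreasing; rewrite lerB.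
  - move=> z; have := tail_ge0 H (x - z); have := tail_le1 H (x - z).
    by rewrite /tail; lra.
have := RintegralB measurableT (bmeas_integrable lam (bmeas_cst _ 1))
  (bmeas_integrable lam bH).
by rewrite (bmeas_int_cst lam) => intB; rewrite /tail /conv -intB.
Qed.

(** P(Y + Z > x, A < Z <= x) for independent Y, Z of law H. *)
Definition mid_conv (A x : R) : R :=
  \int[lam]_z ((A < z <= x)%R%:R * tail H (x - z)).

Let bgt (t : R) : bounded_measurable (fun z : R => (t < z)%R%:R : R).
Proof. exact: bmeas_indic_gt. Qed.

Let blt : bounded_measurable (fun z : R => (z < 0)%R%:R : R).
Proof.
apply: (@bmeas_nonincreasing _ _ _ (fun z => (z < 0)%R%:R) idfun 1) => //; first exact: measurable_id.
- by move=> s t st; rewrite ler_nat; case: (ltP t) => //= /(le_lt_trans st) ->.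
- by move=> z; rewrite ler0n lern1 leq_b1.
Qed.

Let int_lt : \int[lam]_z (z < 0)%R%:R = 0.
Proof.
have m0 : measurable [set z : R | z < 0].
  have -> : [set z : R | z < 0] = `]-oo, 0[%classic.
    by apply/seteqP; split=> z /=; rewrite in_itv.
  exact: measurable_itv.
rewrite /Rintegral -[RHS]/(fine 0%:E); congr fine.
rewrite -[RHS]stieltjes_neg -(setIT [set z : R | z < 0]) -integral_indic//.
apply: eq_integral => w _; rewrite indicE; congr ((nat_of_bool _)%:R%:E).
by apply/idP/idP => [?|]; rewrite ?inE.
Qed.

Lemma bmeas_mid_conv (A x : R) :
  bounded_measurable (fun z : R => (A < z <= x)%R%:R * tail H (x - z)).
Proof.
have [mt [M hM]] := bmeas_tail_shift x; split.
  apply: measurable_funM => //.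
  have [mA _] := bgt A; have [mx _] := bgt x.
  have -> : (fun z : R => (A < z <= x)%R%:R : R) =
      (fun z : R => (A < z)%R%:R * (1 - (x < z)%R%:R)).
    by apply/funext => z; rewrite leNgt; case: (A < z); case: (x < z) => /=; lra.
  apply: measurable_funM => //; apply: measurable_funB => //.
exists M => z; rewrite normrM; apply: le_trans (hM z).
by rewrite -[leRHS]mul1r ler_wpM2r// normr_nat lern1 leq_b1.
Qed.

(** The event Y + Z > x contains, disjointly, Z > x, then Z <= h with Y > x, and
    h < Z <= x with Y > x - h. *)
Lemma conv_tail_long (h x : R) : 0 <= h -> h <= x ->
  tail H (x - h) * (tail H h - tail H x) <=
  tail (conv H H) x - tail H x * (2 - tail H h).
Proof.
move=> h0 hx.
have bL : bounded_measurable (fun z : R => tail H (x - h) * ((h < z)%R%:R + -1 * (x < z)%R%:R)).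
  by apply: bmeasZ; apply: bmeasD; [exact: bgt|apply: bmeasZ; exact: bgt].
have bM : bounded_measurable (fun z : R => tail H x * (1 + -1 * (h < z)%R%:R)).
  by apply: bmeasZ; apply: bmeasD; [exact: bmeas_cst|apply: bmeasZ; exact: bgt].
have bN : bounded_measurable (fun z : R => -1 * (z < 0)%R%:R : R) by exact: bmeasZ blt.
have : \int[lam]_z ((tail H (x - h) * ((h < z)%R%:R + -1 * (x < z)%R%:R) +
    tail H x * (1 + -1 * (h < z)%R%:R)) + ((x < z)%R%:R + -1 * (z < 0)%R%:R)) <=
    \int[lam]_z tail H (x - z).
  apply: bmeas_le.
  - by apply: bmeasD; apply: bmeasD => //; exact: bgt.
  - exact: bmeas_tail_shift.
  move=> z; have t0 := tail_ge0 H (x - z).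
  have tx1 := tail_le1 H x; have tx0 := tail_ge0 H x.
  have [z0|z0] := ltP z 0.
    by have [|_] := ltP h z; [lra|]; have [|_] := ltP x z; [lra|] => /=; lra.
  have [hz|zh] := ltP h z.
    have [xz|zx] := ltP x z => /=.
      have -> : tail H (x - z) = 1 by rewrite /tail H_neg; lra.
      lra.
    have : tail H (x - h) <= tail H (x - z) by apply: tail_nonincr; lra.
    lra.
  have [|zx] := ltP x z => /=; first lra.
  have : tail H x <= tail H (x - z) by apply: tail_nonincr; lra.
  lra.
have gtE t : \int[lam]_z (t < z)%R%:R = tail H t.
  by rewrite -stieltjes_tail -int_indic_gt.
rewrite -conv_tail bmeas_intD; [|exact: bmeasD|apply: bmeasD => //; exact: bgt].
rewrite bmeas_intD// bmeas_intZ; last first.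
  by apply: bmeasD; [exact: bgt|apply: bmeasZ; exact: bgt].
rewrite bmeas_intD; [|exact: bgt|apply: bmeasZ; exact: bgt].
rewrite (bmeas_intZ lam _ (bgt x)) bmeas_intZ; last first.
  by apply: bmeasD; [exact: bmeas_cst|apply: bmeasZ; exact: bgt].
rewrite bmeas_intD; [|exact: bmeas_cst|apply: bmeasZ; exact: bgt].
rewrite (bmeas_intZ lam _ (bgt h)) bmeas_intD; [|exact: bgt|exact: bN].
rewrite (bmeas_intZ lam _ blt) (bmeas_int_cst lam) int_lt !gtE.
lra.
Qed.

(** Remove from Y + Z > x the disjoint events Z > x and Z <= A, Y > x. *)
Lemma mid_conv_le (A x : R) : 0 <= A -> A <= x ->
  mid_conv A x <= tail (conv H H) x - tail H x * (2 - tail H A).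
Proof.
move=> A0 Ax.
have bM : bounded_measurable (fun z : R => tail H x * (1 + -1 * (A < z)%R%:R)).
  by apply: bmeasZ; apply: bmeasD; [exact: bmeas_cst|apply: bmeasZ; exact: bgt].
have bN : bounded_measurable (fun z : R => -1 * (z < 0)%R%:R : R) by exact: bmeasZ blt.
have bm := bmeas_mid_conv A x.
have : \int[lam]_z ((A < z <= x)%R%:R * tail H (x - z) +
    (tail H x * (1 + -1 * (A < z)%R%:R) + ((x < z)%R%:R + -1 * (z < 0)%R%:R))) <=
    \int[lam]_z tail H (x - z).
  apply: bmeas_le.
  - apply: bmeasD => //; apply: bmeasD => //; apply: bmeasD => //; exact: bgt.
  - exact: bmeas_tail_shift.
  move=> z; have t0 := tail_ge0 H (x - z).
  have tx1 := tail_le1 H x; have tx0 := tail_ge0 H x.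
  have [z0|z0] := ltP z 0.
    by have [|_] := ltP A z; [lra|]; have [|_] := ltP x z; [lra|] => /=; lra.
  have [Az|zA] := ltP A z.
    have [xz|zx] := ltP x z => /=; last lra.
    have -> : tail H (x - z) = 1 by rewrite /tail H_neg; lra.
    lra.
  have [|zx] := ltP x z => /=; first lra.
  have : tail H x <= tail H (x - z) by apply: tail_nonincr; lra.
  lra.
have gtE t : \int[lam]_z (t < z)%R%:R = tail H t.
  by rewrite -stieltjes_tail -int_indic_gt.
rewrite -conv_tail bmeas_intD//; last first.
  by apply: bmeasD => //; apply: bmeasD => //; exact: bgt.
rewrite bmeas_intD//; last by apply: bmeasD => //; exact: bgt.
rewrite bmeas_intZ; last first.
  by apply: bmeasD; [exact: bmeas_cst|apply: bmeasZ; exact: bgt].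
rewrite bmeas_intD; [|exact: bmeas_cst|apply: bmeasZ; exact: bgt].
rewrite (bmeas_intZ lam _ (bgt A)) bmeas_intD; [|exact: bgt|exact: bN].
rewrite (bmeas_intZ lam _ blt) (bmeas_int_cst lam) int_lt !gtE /mid_conv.
lra.
Qed.

Hypothesis conv_cvg2 : tail (conv H H) x / tail H x @[x --> +oo] --> (2 : R).

Let conv_near2 (eps : R) : 0 < eps -> exists x0, forall x, x0 <= x ->
  tail (conv H H) x <= (2 + eps) * tail H x.
Proof.
move=> e0; have /cvgrPdist_lt/(_ _ e0)[M [_ hM]] := conv_cvg2.
exists (M + 1) => x Mx.
have /hM : M < x by apply: lt_le_trans Mx; rewrite ltrDl.
rewrite /= distrC => /(le_lt_trans (ler_norm _)) h.
by rewrite -ler_pdivrMr//; lra.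
Qed.

Let tail_near0 (eps : R) : 0 < eps -> exists x0, forall x, x0 <= x ->
  tail H x <= eps.
Proof.
move=> e0; have /cvgrPdist_lt/(_ _ e0)[M [_ hM]] := @tail_cvg0 _ H.
exists (M + 1) => x Mx.
have /hM : M < x by apply: lt_le_trans Mx; rewrite ltrDl.
by rewrite /= sub0r normrN => /(le_lt_trans (ler_norm _))/ltW.
Qed.

(** In [conv_tail_long] the right-hand side is equivalent to
    tail x * tail h, and tail x tends to 0, so that the ratio of tail (x - h) to
    tail x is asymptotically at most 1. *)
Lemma subexponential_long_tailed (h delta : R) : 0 <= h -> 0 < delta ->
  exists x0, forall x, x0 <= x -> tail H (x - h) <= (1 + delta) * tail H x.
Proof.
move=> h0 d0; pose t := tail H h; have t0 : 0 < t by exact: tail_gt0.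
(* eps solves t + eps = (1 + delta) * (t - eps). *)
pose eps := delta * t / (2 + delta).
have d2 : 0 < 2 + delta by lra.
have e0 : 0 < eps by rewrite divr_gt0// mulr_gt0.
have eE : eps * (2 + delta) = delta * t by rewrite /eps divfK// gt_eqF.
have et : eps < t.
  by rewrite -(ltr_pM2r d2) eE; have := mulr_gt0 d0 t0; lra.
have [x1 h1] := conv_near2 e0; have [x2 h2] := tail_near0 e0.
exists (Num.max h (Num.max x1 x2)) => x; rewrite !ge_max => /and3P[hx /h1 D /h2 te].
have := conv_tail_long h0 hx; rewrite -/t => long.
have tx := tail_gt0 x.
have tt : 0 < t - tail H x by lra.
rewrite -(ler_pM2r tt).
have : (t + eps) * tail H x <= (1 + delta) * tail H x * (t - tail H x).
  have -> : (1 + delta) * tail H x * (t - tail H x) =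
    (1 + delta) * (t - tail H x) * tail H x by ring.
  rewrite ler_pM2r//.
  have : (1 + delta) * (t - eps) <= (1 + delta) * (t - tail H x).
    by rewrite ler_pM2l; lra.
  lra.
lra.
Qed.

Lemma mid_conv_small (delta : R) : 0 < delta ->
  exists A1, forall A, A1 <= A -> 0 <= A /\ exists x0, forall x, x0 <= x ->
    mid_conv A x <= delta * tail H x.
Proof.
move=> d0; have d2 : 0 < delta / 2 by lra.
have [x1 h1] := tail_near0 d2; have [x2 h2] := conv_near2 d2.
exists (Num.max 0 x1) => A; rewrite ge_max => /andP[A0 /h1 tA]; split=> //.
exists (Num.max A x2) => x; rewrite ge_max => /andP[Ax /h2 D].
apply: le_trans (mid_conv_le A0 Ax) _.
have := tail_gt0 x => tx.
have : tail H x * tail H A <= tail H x * (delta / 2) by rewrite ler_pM2l.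
lra.
Qed.

End subexponential_estimates.

(** * One step of the upper bound *)

Lemma bmeas_EFin d (T : measurableType d) (R : realType) (P : probability T R)
    (f : T -> R) : bounded_measurable f ->
  (\int[P]_w f w)%:E = (\int[P]_w (f w)%:E)%E.
Proof.
move=> bf; rewrite /Rintegral fineK//; apply: integrable_fin_num => //.
exact: bmeas_integrable.
Qed.

Lemma bmeas_fubini d1 d2 (T1 : measurableType d1) (T2 : measurableType d2)
    (R : realType) (P : probability T1 R) (Q : probability T2 R)
    (f : T1 * T2 -> R) :
  bounded_measurable f -> (forall z, 0 <= f z) ->
  \int[P]_x \int[Q]_y f (x, y) = \int[Q]_y \int[P]_x f (x, y).
Proof.
move=> [mf [M hM]] f0.
have b1 x : bounded_measurable (fun y => f (x, y)).
  split; first by apply: (measurableT_comp mf); exact: measurable_pair1.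
  by exists M => y.
have b2 y : bounded_measurable (fun x => f (x, y)).
  split; first by apply: (measurableT_comp mf); exact: measurable_pair2.
  by exists M => x.
rewrite [LHS]/Rintegral [RHS]/Rintegral; congr fine.
under eq_integral do rewrite (bmeas_EFin Q (b1 _)).
under [RHS]eq_integral do rewrite (bmeas_EFin P (b2 _)).
apply: (@fubini_tonelli _ _ _ _ _ P Q (fun z => (f z)%:E)).
  exact/measurable_EFinP.
by move=> z; rewrite lee_fin.
Qed.

Section upper_bound.
Context d (T : measurableType d) (R : realType) (P : probability T R).
Variable X : T -> R.
Hypothesis mX : measurable_fun setT X.
Variables (F H : dist_fun R) (J : R -> R).
Hypothesis hF : forall t, fine (P [set w | t < X w]) = tail F t.
Hypothesis Jstep : forall x c, 0 <= c ->
  c * tail F (x + c) + J (x + c) <= J x <= c * tail F x + J (x + c).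
Hypothesis J0 : forall x, 0 <= J x.

Local Notation lam := (lebesgue_stieltjes_measure H).

Let bmeas_window (A x : R) : bounded_measurable (fun z : R => (A < z <= x)%R%:R : R).
Proof.
have bI (t : R) : bounded_measurable (fun z : R => (t < z)%R%:R : R).
  exact: bmeas_indic_gt.
have [mA _] := bI A; have [mx _] := bI x; split.
  have -> : (fun z : R => (A < z <= x)%R%:R : R) =
      (fun z : R => (A < z)%R%:R * (1 - (x < z)%R%:R)).
    by apply/funext => z; rewrite leNgt; case: (A < z); case: (x < z) => /=; lra.
  by apply: measurable_funM => //; apply: measurable_funB.
by exists 1 => z; rewrite normr_nat lern1 leq_b1.
Qed.

Let Phi (A x t : R) : R := \int[lam]_z ((A < z <= x)%R%:R * (x - t < z)%R%:R).

Let bmeas_Phi (A x t : R) :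
  bounded_measurable (fun z : R => (A < z <= x)%R%:R * (x - t < z)%R%:R : R).
Proof.
have [mA _] := bmeas_window A x.
have [mx _] : bounded_measurable (fun z : R => (x - t < z)%R%:R : R) by exact: bmeas_indic_gt.
split; first exact: measurable_funM.
by exists 1 => z; rewrite -natrM normr_nat lern1 mulnb leq_b1.
Qed.

Let Phi_bounds A x t : 0 <= Phi A x t <= 1.
Proof.
apply/andP; split; first by apply: Rintegral_ge0 => z _; rewrite mulr_ge0.
rewrite -[leRHS](bmeas_int_cst lam); apply: bmeas_le;
  [exact: bmeas_Phi|exact: bmeas_cst|].
by move=> z; rewrite -natrM lern1 mulnb leq_b1.
Qed.

Let Phi_mon A x s t : s <= t -> Phi A x s <= Phi A x t.
Proof.
move=> st; apply: bmeas_le; [exact: bmeas_Phi..|move=> z]; rewrite ler_wpM2l// ler_nat.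
by case: (ltP (x - s) z) => // h; rewrite (_ : x - t < z)//; lra.
Qed.

Let Phi_int A x b : \int[P]_w Phi A x (b + X w) =
  \int[lam]_z ((A < z <= x)%R%:R * tail F (x - z - b)).
Proof.
pose f (u : T * R) : R := (A < u.2 <= x)%R%:R * (x - (b + X u.1) < u.2)%R%:R.
have bf : bounded_measurable f.
  split; last by exists 1 => u; rewrite /f -natrM normr_nat lern1 mulnb leq_b1.
  apply: measurable_funM.
    by have [m1 _] := bmeas_window A x; exact: (measurableT_comp m1 measurable_snd).
  have mg : measurable_fun setT (fun u : T * R => u.2 + X u.1).
    apply: measurable_funD; first exact: measurable_snd.
    exact: (measurableT_comp mX).
  have [m2 _] := bmeas_indic_gt (x - b) mg.
  rewrite (_ : (fun u : T * R => _) = fun u : T * R => (x - b < u.2 + X u.1)%R%:R)//.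
  apply/funext => u; congr ((nat_of_bool _)%:R); apply/idP/idP => h; lra.
have f0 u : 0 <= f u by rewrite mulr_ge0.
have := bmeas_fubini P lam bf f0; rewrite /f /= => ->.
apply: eq_Rintegral => z _.
rewrite (@bmeas_intZ _ _ _ P _ (fun w => (x - (b + X w) < z)%R%:R)); last first.
  rewrite (_ : (fun w => _) = fun w => (x - z - b < X w)%R%:R).
    exact: bmeas_indic_gt.
  apply/funext => w; congr ((nat_of_bool _)%:R); apply/idP/idP => h; lra.
congr (_ * _); rewrite -hF -int_indic_gt//.
apply: eq_Rintegral => w _; congr ((nat_of_bool _)%:R); apply/idP/idP => h; lra.
Qed.

(** In [max_tail_crossing] take for G t the indicator of t > x - A plus
    C * P(x - t < Z <= x, A < Z), where Z has law H, and K = C * tail x: for a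
    restart at t <= x - A the bound C * tail (x - t) is C times the probability
    of Z > x - t, which lies in these two parts.  Exchanging the jump and Z, the
    second part of G sums to 1/c times the expectation of J (x - Z - L - c) on
    A < Z <= x, hence to a multiple of [mid_conv]. *)
Lemma max_tail_upper (c L A C CJ gamma x : R) (N : nat) :
  0 < c -> 0 <= L -> 0 <= C -> 0 <= A -> L <= x -> A <= x ->
  (forall u, A <= u -> max_tail P X N u <= C * tail H u) ->
  (forall u, 0 <= u -> J (u - L - c) <= CJ * tail H u) ->
  (forall m, max_tail P (fun w => X w + c) m L <= gamma) ->
  c * max_tail P X N.+1 x <=
  J (x - A - L - c) + C * CJ * mid_conv H A x + c * C * gamma * tail H x.
Proof.
move=> c0 L0 C0 A0 Lx Ax hN hJ hgamma.
pose G t := (x - A < t)%R%:R + C * Phi A x t.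
have GB t : 0 <= G t <= 1 + C.
  have /andP[p0 p1] := Phi_bounds A x t.
  have Cp : 0 <= C * Phi A x t by exact: mulr_ge0.
  have Cp1 : C * Phi A x t <= C by rewrite -[leRHS]mulr1 ler_wpM2l.
  have b1 : ((x - A < t)%R%:R : R) <= 1 by rewrite lern1 leq_b1.
  have b0 : 0 <= ((x - A < t)%R%:R : R) by [].
  by rewrite /G; apply/andP; split; lra.
have Gmon s t : s <= t -> G s <= G t.
  move=> st; apply: lerD; last by rewrite ler_wpM2l// Phi_mon.
  by rewrite ler_nat; case: (ltP (x - A) s) => //= /lt_le_trans ->.
have K0 : 0 <= C * tail H x by rewrite mulr_ge0// tail_ge0.
have gtE t : \int[lam]_z (t < z)%R%:R = tail H t.
  by rewrite -stieltjes_tail -int_indic_gt.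
have GK t : max_tail P X N (x - t) <= G t + C * tail H x.
  rewrite /G; have [cross|ncross] := ltP (x - A) t.
    have /andP[p0 _] := Phi_bounds A x t.
    have := max_tail_le1 P mX N (x - t); have := mulr_ge0 C0 p0 => /=; lra.
  apply: le_trans (hN _ _) _; first lra.
  rewrite add0r -mulrDr ler_wpM2l// -!gtE /Phi -bmeas_intD; last 2 first.
  - exact: bmeas_Phi.
  - exact: bmeas_indic_gt.
  apply: bmeas_le.
  - exact: bmeas_indic_gt.
  - by apply: bmeasD; [exact: bmeas_Phi|exact: bmeas_indic_gt].
  move=> z; have [h|h] := ltP (x - t) z => /=; last by rewrite mulr0 add0r.
  have -> /= : A < z by lra.
  by rewrite [z <= x]leNgt; case: (x < z) => /=; lra.
have := max_tail_crossing mX (ltW c0) K0 GB Gmon GK (leqnn _) L0 Lx.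
rewrite !subr0 => /(ler_wpM2l (ltW c0)) h; apply: le_trans h _.
have GI b : \int[P]_w G (b + X w) =
    tail F (x - A - b) + C * \int[lam]_z ((A < z <= x)%R%:R * tail F (x - z - b)).
  have mb : measurable_fun setT (fun w => b + X w).
    by apply: measurable_funD => //; exact: measurable_cst.
  have bP : bounded_measurable (fun w => Phi A x (b + X w)).
    apply: (@bmeas_nondecreasing _ _ _ (Phi A x) (fun w => b + X w) 1).
    - exact: mb.
    - exact: Phi_mon.
    - exact: Phi_bounds.
  rewrite bmeas_intD; [|exact: bmeas_indic_gt|exact: bmeasZ].
  rewrite bmeas_intZ// Phi_int -hF -(int_indic_gt P _ mX); congr (_ + _).
  apply: eq_Rintegral => w _; congr ((nat_of_bool _)%:R); apply/idP/idP => hh; lra.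
rewrite mulrDr; apply: lerD; last first.
  rewrite !mulrA [leRHS]mulrAC ler_wpM2l//.
  by rewrite !mulr_ge0 ?tail_ge0// ltW.
under eq_bigr do rewrite GI.
rewrite big_split /= mulrDr; apply: lerD.
  rewrite (eq_bigr (fun k : 'I_N.+1 => tail F (x - A - L + k%:R * c))).
    exact: (sum_tail_le_integral Jstep J0 (ltW c0)).
  by move=> k _; congr (tail F _); ring.
rewrite -mulr_sumr mulrCA -mulrA ler_wpM2l//.
have bw b : bounded_measurable (fun z : R => (A < z <= x)%R%:R * tail F (x - z - b)).
  have [mw _] := bmeas_window A x; split.
    apply: measurable_funM => //.
    have mh : measurable_fun setT (fun z : R => x - z - b).
      apply: measurable_funB; last exact: measurable_cst.
      by apply: measurable_funB => //; exact: measurable_cst.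
    apply: (measurableT_comp _ mh); apply: nonincreasing_measurable => // s t.
    exact: tail_nonincr.
  exists 1 => z; rewrite normrM normr_nat (ger0_norm (tail_ge0 _ _)).
  by rewrite mulr_ile1// ?lern1 ?leq_b1 ?tail_ge0 ?tail_le1.
have sumE : forall n, bounded_measurable (fun z : R => (A < z <= x)%R%:R *
       \sum_(k < n) tail F (x - z - (L - k%:R * c))) /\
    \sum_(k < n) \int[lam]_z ((A < z <= x)%R%:R * tail F (x - z - (L - k%:R * c))) =
    \int[lam]_z ((A < z <= x)%R%:R * \sum_(k < n) tail F (x - z - (L - k%:R * c))).
  elim=> [|n [IHb IH]].
    have e0 : (fun z : R => (A < z <= x)%R%:R * \sum_(k < 0) tail F (x - z - (L - k%:R * c))) = fun=> 0.
      by apply/funext => z; rewrite big_ord0 mulr0.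
    by rewrite e0 big_ord0 bmeas_int_cst; split=> //; exact: bmeas_cst.
  have eS : (fun z : R => (A < z <= x)%R%:R * \sum_(k < n.+1) tail F (x - z - (L - k%:R * c))) =
      fun z => (A < z <= x)%R%:R * \sum_(k < n) tail F (x - z - (L - k%:R * c)) +
      (A < z <= x)%R%:R * tail F (x - z - (L - n%:R * c)).
    by apply/funext => z; rewrite big_ord_recr mulrDr.
  have bn := bw (L - n%:R * c).
  by rewrite eS big_ord_recr /= IH bmeas_intD//; split=> //; exact: bmeasD.
have [bS ->] := sumE N.+1.
rewrite -bmeas_intZ// /mid_conv -bmeas_intZ; last exact: bmeas_mid_conv.
apply: bmeas_le; [exact: bmeasZ|apply: bmeasZ; exact: bmeas_mid_conv|move=> z].
rewrite mulrCA [leRHS]mulrCA; have [/andP[Az zx]|_] := boolP (A < z <= x); last by rewrite !mul0r.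
rewrite !mul1r; apply: (le_trans _ (hJ (x - z) _)); last lra.
rewrite (eq_bigr (fun k : 'I_N.+1 => tail F (x - z - L + k%:R * c))).
  exact: (sum_tail_le_integral Jstep J0 (ltW c0)).
by move=> k _; congr (tail F _); ring.
Qed.

End upper_bound.

(** * Asymptotic bounds *)

Section asymptotics.
Context d (T : measurableType d) (R : realType) (P : probability T R).
Variable X : T -> R.
Hypothesis mX : measurable_fun setT X.
Variables (F H : dist_fun R) (J : R -> R) (a : R).
Hypothesis a0 : 0 < a.
Hypothesis hF : forall t, fine (P [set w | t < X w]) = tail F t.
Hypothesis tail_gt0 : forall x, 0 < tail H x.
Hypothesis Jstep : forall x c, 0 <= c ->
  c * tail F (x + c) + J (x + c) <= J x <= c * tail F x + J (x + c).
Hypothesis J0 : forall x, 0 <= J x.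
Hypothesis Jmon : forall x y, x <= y -> J y <= J x.
Hypothesis JH : exists x1, forall x, x1 <= x -> J x = tail H x.
Hypothesis H_long : forall h delta, 0 <= h -> 0 < delta ->
  exists x0, forall x, x0 <= x -> tail H (x - h) <= (1 + delta) * tail H x.

Section lower.
Variable p : R -> R.
Hypothesis p_ge : forall N x, max_tail P X N x <= p x.
Hypothesis p_vanish : forall eta, 0 < eta -> exists A, forall x, A <= x -> p x <= eta.
Hypothesis down_vanish : forall c, a < c -> forall eta, 0 < eta ->
  exists2 L, 0 <= L & forall N, max_tail P (fun w => - X w - c) N L <= eta.

(** [max_tail_lower] with l = - L and s = 0, where L is chosen such that the walk
    falls below the line with probability at most delta. *)
Lemma tail_lower_bound (eta : R) : 0 < eta ->
  exists x0, forall x, x0 <= x -> (a^-1 - eta) * tail H x <= p x.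
Proof.
move=> eta0.
have b0 : 0 < a^-1 by rewrite invr_gt0.
(* delta satisfies (1 - 4 * delta) / (a + delta) >= 1 / a - eta. *)
pose delta := Num.min (1 / 8) (eta * a / (4 + a^-1)).
have d0 : 0 < delta by rewrite lt_min !divr_gt0 ?mulr_gt0//; lra.
have d8 : delta <= 1 / 8 by rewrite ge_min lexx.
have dE : delta * (4 + a^-1) <= eta * a.
  by rewrite -ler_pdivlMr ?ge_min ?lexx ?orbT//; lra.
pose c := a + delta.
have ac : a < c by rewrite /c; lra.
have c0 : 0 < c by apply: lt_trans ac.
have [L L0 hL] := down_vanish ac d0.
have [A hA] := p_vanish d0.
have [x1 h1] := JH.
have [x2 h2] := H_long L0 d0.
exists (Num.max A (Num.max x1 x2)) => x; rewrite !ge_max => /and3P[/hA px x1x x2x].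
have JE : J (x + L) = tail H (x + L) by apply: h1; lra.
have JL : tail H x <= (1 + delta) * tail H (x + L).
  by have := h2 (x + L); rewrite addrK; apply; lra.
have JL0 : 0 < J (x + L) by rewrite JE.
have [N hN] : exists N : nat, J (x + L + N%:R * c) <= delta * J (x + L).
  have e0 : 0 < delta * J (x + L) by exact: mulr_gt0.
  have /cvgrPdist_lt/(_ _ e0)[M [_ hM]] := @tail_cvg0 _ H.
  have [N _ /(_ N (leqnn N)) /= NM] :=
    nbhs_infty_gtr ((Num.max M x1 - (x + L)) / c).
  exists N; rewrite ltr_pdivrMr// ltrBlDr gt_max in NM.
  case/andP: NM => NM Nx1; rewrite h1; last by rewrite addrC ltW.
  have /hM /= : M < x + L + N%:R * c by rewrite addrC.
  by rewrite sub0r normrN => /(le_lt_trans (ler_norm _))/ltW.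
have := integral_le_sum_tail Jstep (ltW c0) N (x + L).
set S := \sum_(k < N) _ => JS.
have := max_tail_lower P mX x c N (- L) 0.
rewrite subr0 sub0r opprK (eq_bigr (fun k : 'I_N => tail F (x + L + k%:R * c))); last by move=> k _; rewrite hF.
rewrite -/S => low.
have pN := p_ge N x; have rN := hL N.
set q := max_tail P X N x in low pN; set r := max_tail P _ N L in low rN.
have S0 : 0 <= S by apply: sumr_ge0 => k _; exact: tail_ge0.
have low2 : (1 - 2 * delta) * S <= p x.
  apply: le_trans (le_trans low pN); rewrite ler_wpM2r//; lra.
have low3 : (1 - 2 * delta) * ((1 - delta) * J (x + L)) <= c * p x.
  apply: (@le_trans _ _ (c * ((1 - 2 * delta) * S))); last by rewrite ler_pM2l.
  rewrite [leRHS]mulrCA ler_wpM2l//; lra.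
have t0 := tail_gt0 x.
have low4 : (1 - delta) * tail H x <= J (x + L).
  rewrite JE; apply: (@le_trans _ _ ((1 - delta) * ((1 + delta) * tail H (x + L)))).
    rewrite ler_wpM2l//; lra.
  rewrite mulrA -[leRHS]mul1r ler_wpM2r ?tail_ge0//.
  have := sqr_ge0 delta; rewrite expr2; lra.
have low5 : (1 - 4 * delta) * tail H x <= c * p x.
  apply: le_trans low3.
  apply: (@le_trans _ _ ((1 - 2 * delta) * ((1 - delta) * ((1 - delta) * tail H x)))).
    rewrite !mulrA ler_wpM2r//; first exact: ltW.
    have := mulr_ge0 (ltW d0) (ltW d0) => dd.
    have : delta * (delta * delta) <= delta * delta by rewrite ler_piMl//; lra.
    lra.
  rewrite ler_wpM2l ?ler_wpM2l//; lra.
rewrite -(ler_pM2l c0); apply: le_trans low5; rewrite mulrA ler_wpM2r ?(ltW t0)//.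
have ab : a * a^-1 = 1 by rewrite divff// gt_eqF.
have : 0 <= delta * eta by rewrite mulr_ge0// ltW.
rewrite /c; lra.
Qed.

End lower.

Section upper.
Hypothesis H_mid : forall delta, 0 < delta ->
  exists A1, forall A, A1 <= A -> 0 <= A /\ exists x0, forall x, x0 <= x ->
    mid_conv H A x <= delta * tail H x.
Hypothesis up_vanish : forall c, c < a -> forall eta, 0 < eta ->
  exists2 L, 0 <= L & forall N, max_tail P (fun w => X w + c) N L <= eta.

(** Far to the right this is long-tailedness; on a bounded interval J is bounded
    and the tail of H is bounded away from 0. *)
Lemma integrated_tail_shift_le (h : R) : 0 <= h ->
  exists2 K, 0 <= K & forall u, 0 <= u -> J (u - h) <= K * tail H u.
Proof.
move=> h0; have [x1 h1] := JH; have [x2 h2] := H_long h0 ltr01.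
pose y := Num.max 0 (Num.max (x1 + h) x2).
have ty : 0 < tail H y by [].
have y1 : x1 + h <= y by rewrite /y !le_max lexx orbT.
have y2 : x2 <= y by rewrite /y !le_max lexx !orbT.
have K0 : 0 <= J (- h) / tail H y by rewrite divr_ge0// ltW.
exists (2 + J (- h) / tail H y); first by lra.
move=> u u0; have tu := tail_gt0 u; rewrite mulrDl.
have Kt : 0 <= J (- h) / tail H y * tail H u by rewrite mulr_ge0// ltW.
have [yu|uy] := leP y u.
  have := h2 u (le_trans y2 yu); rewrite h1; lra.
have : J (- h) <= J (- h) / tail H y * tail H u.
  rewrite mulrAC ler_pdivlMr// ler_wpM2l//; apply: tail_nonincr; exact: ltW.
have : J (u - h) <= J (- h) by apply: Jmon; lra.
lra.
Qed.

(** The level [x0] depends on A but not on C and N, which makes the inequality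
    usable both in an induction on N and for improving the constant. *)
Lemma max_tail_contraction (c L delta gamma : R) :
  0 < c -> 0 <= L -> 0 < delta ->
  (forall m, max_tail P (fun w => X w + c) m L <= gamma) ->
  exists A1, forall A, A1 <= A -> exists x0, [/\ A <= x0, 0 <= x0 &
    forall x C N, x0 <= x -> 0 <= C ->
    (forall u, A <= u -> max_tail P X N u <= C * tail H u) ->
    max_tail P X N.+1 x <= ((1 + delta) / c + (delta + gamma) * C) * tail H x].
Proof.
move=> c0 L0 d0 hgamma.
have Lc0 : 0 <= L + c by rewrite addr_ge0// ltW.
have [K K0 hK] := integrated_tail_shift_le Lc0.
have K1 : 0 < K + 1 by lra.
have d'0 : 0 < delta * c / (K + 1) by rewrite divr_gt0// mulr_gt0.
have [A1 hA1] := H_mid d'0; exists A1 => A AA1.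
have [A0 [x1 h1]] := hA1 A AA1.
have [x2 h2] := JH.
have ALc0 : 0 <= A + L + c by lra.
have [x3 h3] := H_long ALc0 d0.
exists (Num.max (Num.max A L) (Num.max x1 (Num.max (x2 + (A + L + c)) x3))).
split; [by rewrite !le_max lexx|by rewrite !le_max A0|].
move=> x C N; rewrite !ge_max => /and3P[/andP[Ax Lx] /h1 mid /andP[x2x /h3 long]] C0 hN.
have t0 := tail_gt0 x.
have hJ u : 0 <= u -> J (u - L - c) <= K * tail H u.
  by move=> /hK; rewrite opprD addrA.
have := max_tail_upper mX hF Jstep J0 c0 L0 C0 A0 Lx Ax hN hJ hgamma.
have -> : x - A - L - c = x - (A + L + c) by ring.
rewrite h2; last by lra.
move=> up; rewrite -(ler_pM2l c0); apply: le_trans up _.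
have midK : C * K * mid_conv H A x <= C * (delta * c) * tail H x.
  rewrite -!mulrA ler_wpM2l//; apply: (@le_trans _ _ (K * (delta * c / (K + 1) * tail H x))).
    by rewrite ler_wpM2l.
  rewrite mulrA mulrA ler_wpM2r ?(ltW t0)//.
  have -> : K * (delta * c / (K + 1)) = (delta * c) * (K / (K + 1)) by field; rewrite gt_eqF.
  rewrite ler_piMr ?mulr_ge0 ?ltW// ltr_pdivrMr//; lra.
have -> : c * (((1 + delta) / c + (delta + gamma) * C) * tail H x) =
  (1 + delta) * tail H x + C * (delta * c) * tail H x + c * C * gamma * tail H x.
  by field; rewrite gt_eqF.
lra.
Qed.

(** Induction on N with a constant C0 that is trivially sufficient to the left of
    [x0] and stable under C |-> kappa + theta * C gives an a priori bound, uniform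
    in N; then [affine_iteration] improves the constant. *)
Lemma max_tail_upper_asymptotic (c L delta gamma : R) :
  0 < c -> 0 <= L -> 0 < delta -> 0 <= gamma -> delta + gamma < 1 ->
  (forall m, max_tail P (fun w => X w + c) m L <= gamma) ->
  forall eta, 0 < eta -> exists x0, forall x, x0 <= x -> forall N,
  max_tail P X N x <= ((1 + delta) / c / (1 - (delta + gamma)) + eta) * tail H x.
Proof.
move=> c0 L0 d0 g0 dg1 hgamma.
have [A1 hA1] := max_tail_contraction c0 L0 d0 hgamma.
have kappa0 : 0 <= (1 + delta) / c by rewrite divr_ge0//; lra.
have theta1 : 0 < 1 - (delta + gamma) by lra.
set kappa := (1 + delta) / c in kappa0 hA1 *.
set theta := delta + gamma in theta1 dg1 hA1 *.
have [x0 [A1x0 x00 hx0]] := hA1 A1 (lexx _).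
pose C0 := Num.max (tail H x0)^-1 (kappa / (1 - theta)).
have C00 : 0 <= C0 by rewrite /C0 le_max invr_ge0 ltW.
have apriori N x : max_tail P X N x <= C0 * tail H x.
  elim: N x => [|N IH] x; have [xx0|x0x] := ltP x x0.
  - apply: le_trans (max_tail_le1 P mX _ _) _.
    apply: (@le_trans _ _ ((tail H x0)^-1 * tail H x)).
      by rewrite mulrC ler_pdivlMr// mul1r tail_nonincr// ltW.
    by rewrite ler_wpM2r ?(ltW (tail_gt0 _))// /C0 le_max lexx.
  - rewrite max_tail0; last exact: le_trans x0x.
    by apply: mulr_ge0 => //; exact: ltW.
  - apply: le_trans (max_tail_le1 P mX _ _) _.
    apply: (@le_trans _ _ ((tail H x0)^-1 * tail H x)).
      by rewrite mulrC ler_pdivlMr// mul1r tail_nonincr// ltW.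
    by rewrite ler_wpM2r ?(ltW (tail_gt0 _))// /C0 le_max lexx.
  - apply: le_trans (hx0 x C0 N x0x C00 (fun u _ => IH u)) _.
    rewrite ler_wpM2r ?(ltW (tail_gt0 _))//.
    have : kappa <= C0 * (1 - theta).
      by rewrite -ler_pdivrMr// /C0 le_max lexx orbT.
    lra.
apply: (@affine_iteration _ (fun C => exists x0, forall x, x0 <= x -> forall N,
  max_tail P X N x <= C * tail H x) kappa theta C0) => //.
- by rewrite dg1 andbT addr_ge0// ltW.
- by exists 0 => x _ N; exact: apriori.
- move=> C C' CC' [y hy]; exists y => x yx N.
  by apply: le_trans (hy x yx N) _; rewrite ler_wpM2r// ltW.
- move=> C C_0 [y hy].
  have A1y : A1 <= Num.max A1 y by rewrite le_max lexx.
  have [x1 [_ _ h1]] := hA1 _ A1y.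
  exists x1 => x x1x N; apply: le_trans (max_tail_le P mX x (leqnSn N)) _.
  apply: h1 => // u; rewrite ge_max => /andP[_ yu]; exact: hy.
Qed.

(** Letting c = a - delta, with the line passed with probability at most delta,
    and delta tend to 0 in [max_tail_upper_asymptotic]. *)
Lemma tail_upper_bound (eta : R) : 0 < eta ->
  exists x0, forall x, x0 <= x -> forall N,
  max_tail P X N x <= (a^-1 + eta) * tail H x.
Proof.
move=> eta0; set b := a^-1; have b0 : 0 < b by rewrite invr_gt0.
have ab : a * b = 1 by rewrite divff// gt_eqF.
pose e := eta / 2; have e0 : 0 < e by rewrite divr_gt0.
have eE : eta = e + e by rewrite /e -splitr.
clearbody b e.
(* delta * D <= e * a ensures
   1 + delta <= (b + e) * (a - delta) * (1 - 2 * delta). *)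
pose D := 1 + (b + e) * (1 + 2 * a).
have D0 : 0 < D by rewrite /D ltr_pwDl// mulr_ge0// addr_ge0 ?mulr_ge0// ltW.
pose delta := Num.min (Num.min (1 / 4) (a / 2)) (e * a / D).
have d0 : 0 < delta by rewrite !lt_min !divr_gt0 ?mulr_gt0.
have d4 : delta <= 1 / 4 by rewrite !ge_min lexx.
have da : delta <= a / 2 by rewrite !ge_min lexx orbT.
have dD : delta * D <= e * a by rewrite -ler_pdivlMr// !ge_min lexx !orbT.
have c0 : 0 < a - delta by lra.
have ca : a - delta < a by rewrite ltrBlDr ltrDl.
have [L L0 hL] := up_vanish ca d0.
have dd1 : delta + delta < 1 by lra.
have [x0 h0] := max_tail_upper_asymptotic c0 L0 d0 (ltW d0) dd1 hL e0.
exists x0 => x x0x N; apply: le_trans (h0 x x0x N) _.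
rewrite ler_wpM2r ?(ltW (tail_gt0 _))//.
have d1 : 0 < 1 - (delta + delta) by lra.
suff : (1 + delta) / (a - delta) / (1 - (delta + delta)) <= b + e.
  by rewrite eE; lra.
rewrite ler_pdivrMr// ler_pdivrMr//.
have dd : 0 <= delta * delta * (b + e) by rewrite !mulr_ge0//; lra.
have : (b + e) * (1 + 2 * a) * delta + delta <= e * a.
  by apply: le_trans dD; rewrite /D le_eqVlt; apply/orP; left; apply/eqP; ring.
lra.
Qed.

End upper.
End asymptotics.

(** * The supremum of the walk *)

Section iid_walk.
Context d (T : measurableType d) (R : realType) (P : probability T R).
Variable xi : nat -> {RV P >-> R}.
Hypothesis hindep : mutually_independent xi.
Hypothesis hident : forall n (B : set R), measurable B ->
  P (xi n @^-1` B) = P (xi 0%N @^-1` B).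

(** The line of slope half the drift is passed with probability smaller than one,
    since the walk with the correspondingly shifted steps still has a negative
    mean. *)
Lemma negative_drift_max_tail_cvg0 (f : R -> R) : measurable_fun setT f ->
  P.-integrable setT (EFin \o (f \o xi 0%N)) ->
  \int[P]_w f (xi 0%N w) < 0 ->
  forall eta, 0 < eta ->
  exists2 A, 0 <= A & forall N, max_tail P (f \o xi 0%N) N A <= eta.
Proof.
move=> mf intf mean0 eta eta0.
set mean := \int[P]_w _ in mean0.
pose c := - mean / 2.
have c0 : 0 < c by rewrite divr_gt0// oppr_gt0.
have mfc : measurable_fun setT (fun y => f y + c).
  by apply: measurable_funD => //; exact: measurable_cst.
have icst : P.-integrable setT (EFin \o (fun=> c)).
  exact: finite_measure_integrable_cst.
have ifc : P.-integrable setT (EFin \o ((fun y => f y + c) \o xi 0%N)).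
  exact: (integrableD measurableT intf icst).
have meanc : \int[P]_w (f (xi 0%N w) + c) < 0.
  have := RintegralD measurableT intf icst.
  by rewrite (bmeas_int_cst P c) /= => ->; rewrite -/mean /c; lra.
have [L [rho [L0 rho1 hL]]] := walk_max_tail_lt1 hindep hident mfc ifc meanc.
have [A hA] := max_tail_vanish intf c0 L0 rho1 hL eta0.
exists (Num.max 0 A); first by rewrite le_max lexx.
move=> N; apply: le_trans (hA N); apply: max_tail_nonincr.
  exact: measurableT_comp.
by rewrite le_max lexx orbT.
Qed.

Lemma walk_sup_gtE (x : R) : [set w | (x%:E < walk_sup xi w)%E] =
  \bigcup_N [set w | x < walk_max xi id 0 N w].
Proof.
apply/seteqP; split=> w /=.
  move=> /ereal_sup_gtP[_ [n _ <-]]; rewrite lte_fin => xn.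
  by exists n => //=; apply/walk_max_gt; exists n.
move=> [N _ /= /walk_max_gt[n _ xn]]; apply/ereal_sup_gtP.
by exists (walk xi n w)%:E; [exists n|rewrite lte_fin].
Qed.

Let mgt N (x : R) : measurable [set w | x < walk_max xi id 0 N w].
Proof. by apply: measurable_gt; apply: measurable_walk_max. Qed.

Let mU (x : R) : measurable (\bigcup_N [set w | x < walk_max xi id 0 N w]).
Proof. by apply: bigcup_measurable => N _. Qed.

Lemma walk_sup_tail_ge N x : max_tail P (xi 0%N) N x <=
  fine (P [set w | (x%:E < walk_sup xi w)%E]).
Proof.
have := walk_max_tail hindep hident (@measurable_id _ _ setT) N 0 x.
rewrite -[RHS]/(max_tail P (xi 0%N) N x) => <-.
rewrite walk_sup_gtE fine_le//; [exact/fin_num_measure/mgt|exact/fin_num_measure/mU|].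
by apply: le_measure; rewrite ?inE; [exact: mgt|exact: mU|move=> w h; exists N].
Qed.

Lemma walk_sup_tail_le x B : (forall N, max_tail P (xi 0%N) N x <= B) ->
  fine (P [set w | (x%:E < walk_sup xi w)%E]) <= B.
Proof.
move=> hB; rewrite walk_sup_gtE -lee_fin fineK; last exact/fin_num_measure/mU.
have cv : P [set w | x < walk_max xi id 0 N w] @[N --> \oo] -->
    P (\bigcup_N [set w | x < walk_max xi id 0 N w]).
  apply: nondecreasing_cvg_mu => //.
  apply/nondecreasing_seqP => N; apply/subsetPset => w /= /lt_le_trans; apply.
  exact: walk_max_homo.
apply: (cvge_to_le cv).
apply: nearW => N; rewrite -(fineK (fin_num_measure P _ (mgt N x))) lee_fin.
by rewrite (walk_max_tail hindep hident (@measurable_id _ _ setT)).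
Qed.

End iid_walk.

(** * The asymptotics of the supremum *)

Lemma subexponential_conv (R : realType) (H : dist_fun R) :
  subexponential_nonneg H ->
  tail (conv H H) x / tail H x @[x --> +oo] --> (2 : R).
Proof. by move=> [_ /(_ 2%N (leqnn _))]. Qed.

Theorem theorem1 (R : realType) (d : measure_display) (T : measurableType d)
    (P : probability T R) (xi : nat -> {RV P >-> R})
    (F Fs : dist_fun R) (a : R)
    (hindep : mutually_independent xi)
    (hF : forall (n : nat) (x : R), cdf (xi n) x = (F x)%:E)
    (hint : P.-integrable [set: T] (EFin \o xi 0%N))
    (hmean : ('E_P[xi 0%N] = (- a)%:E)%E)
    (ha : - a < 0)
    (hFs : is_second_tail F Fs) :
  (long_tailed Fs ->
    ((a^-1)%:E <=
      limf_einf (fun x : R =>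
        (fine (P [set w | (x%:E < walk_sup xi w)%E]) / tail Fs x)%:E)
        (+oo%R : set_system R))%E)
  /\
  (subexponential Fs ->
    fine (P [set w | (x%:E < walk_sup xi w)%E]) / tail Fs x
      @[x --> +oo] --> a^-1).
Proof.
have a0 : 0 < a by rewrite -oppr_lt0.
have tailF n t : P (xi n @^-1` `]t, +oo[%classic) = (tail F t)%:E.
  have -> : xi n @^-1` `]t, +oo[%classic = ~` (xi n @^-1` `]-oo, t]%classic).
    by apply/seteqP; split=> w /=; rewrite !in_itv/= andbT ltNge => /negP.
  rewrite probability_setC; last exact: (measurable_funPTI (xi n)).
  by have := hF n t; rewrite /cdf /distribution /pushforward /= => ->.
have hident n (B : set R) : measurable B ->
    P (xi n @^-1` B) = P (xi 0%N @^-1` B).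
  move=> mB; apply: (@probability_eq_tails R (distribution P (xi n)) (distribution P (xi 0%N))) => // t.
  exact: (eq_trans (tailF n t) (esym (tailF 0%N t))).
have mX : measurable_fun setT (xi 0%N) by [].
have hF0 t : fine (P [set w | t < xi 0%N w]) = tail F t.
  rewrite -[RHS]/(fine (tail F t)%:E) -(tailF 0%N); congr (fine (P _)).
  by apply/seteqP; split=> w /=; rewrite in_itv/= andbT.
have mean0 : \int[P]_w xi 0%N w = - a.
  by rewrite /Rintegral; move: hmean; rewrite expectation_def => ->.
have iX : P.-integrable setT (EFin \o xi 0%N) by exact: hint.
have icst c : P.-integrable setT (EFin \o (fun=> c)).
  exact: finite_measure_integrable_cst.
have mcst c : measurable_fun setT (fun=> c : R) by [].
have up_vanish c : c < a -> forall eta, 0 < eta ->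
    exists2 L, 0 <= L & forall N, max_tail P (fun w => xi 0%N w + c) N L <= eta.
  move=> ca; apply: (@negative_drift_max_tail_cvg0 _ _ _ P xi hindep hident (fun y => y + c)).
  - by apply: measurable_funD.
  - exact: (integrableD measurableT iX (icst c)).
  - have := RintegralD measurableT iX (icst c).
    by rewrite (bmeas_int_cst P c) mean0 => ->; lra.
have down_vanish c : a < c -> forall eta, 0 < eta ->
    exists2 L, 0 <= L & forall N, max_tail P (fun w => - xi 0%N w - c) N L <= eta.
  move=> ac; apply: (@negative_drift_max_tail_cvg0 _ _ _ P xi hindep hident (fun y => - y - c)).
  - by apply: measurable_funB => //; exact: measurableT_comp.
  - exact: (integrableB measurableT (integrableN iX) (icst c)).
  - have := RintegralB measurableT (integrableN iX) (icst c).
    have := RintegralZl (-1) measurableT iX.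
    rewrite (bmeas_int_cst P c) mean0 => int1 int2.
    have int3 : \int[P]_w (- xi 0%N w) = a.
      by rewrite -[RHS]opprK -mulN1r -int1; apply: eq_Rintegral => w _; rewrite mulN1r.
    rewrite [X in X < 0](_ : _ = a - c); first lra.
    by rewrite -[in RHS]int3.
pose p x := fine (P [set w | (x%:E < walk_sup xi w)%E]).
have p_ge N x : max_tail P (xi 0%N) N x <= p x by exact: walk_sup_tail_ge.
have p_le x B : (forall N, max_tail P (xi 0%N) N x <= B) -> p x <= B.
  exact: walk_sup_tail_le.
have p_vanish eta : 0 < eta -> exists A, forall x, A <= x -> p x <= eta.
  move=> eta0; have [A _ hA] := up_vanish 0 a0 eta eta0.
  exists A => x Ax; apply: p_le => N; apply: le_trans (hA N).
  rewrite (_ : (fun w => xi 0%N w + 0) = xi 0%N); last by apply/funext => w; rewrite addr0.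
  exact: max_tail_nonincr.
have [J [Jstep J0 Jmon JFs]] := integrated_tail hFs.
split=> [[tail_gt0 long]|[tail_gt0' subexp]].
  have H_long h delta : 0 <= h -> 0 < delta -> exists x0, forall x, x0 <= x ->
      tail Fs (x - h) <= (1 + delta) * tail Fs x.
    move=> _ d0; have /cvgrPdist_lt/(_ _ d0)[M [_ hM]] := long h.
    exists (M + 1) => x Mx.
    have /hM : M < x by apply: lt_le_trans Mx; rewrite ltrDl.
    rewrite /= distrC => /(le_lt_trans (ler_norm _)) h'.
    by rewrite -ler_pdivrMr//; lra.
  apply/lee_subgt0Pr => e e0.
  have [x0 hx0] := tail_lower_bound mX a0 hF0 tail_gt0 Jstep JFs H_long p_ge p_vanish down_vanish e0.
  rewrite limf_einfE; apply: le_ereal_sup_tmp.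
  exists (ereal_inf ((fun x : R => (p x / tail Fs x)%:E) @` [set x | x0 <= x])).
    exists [set x | x0 <= x] => //.
    by apply: nbhs_pinfty_ge; exact: num_real.
  apply: le_ereal_inf_tmp => _ [x /= /hx0 hx <-].
  by rewrite -EFinB lee_fin ler_pdivlMr.
pose H : dist_fun R := pos_part Fs.
have HFs x : 0 <= x -> tail H x = tail Fs x.
  by move=> x0; rewrite /tail /H /= /pos_part x0.
have H_neg x : x < 0 -> H x = 0.
  by move=> x0; rewrite /H /= /pos_part leNgt x0.
have conv2 := @subexponential_conv R H (conj tail_gt0' subexp).
have tail_gt0 : forall x, 0 < tail H x := tail_gt0'.
have H_long := @subexponential_long_tailed R H H_neg tail_gt0 conv2.
have H_mid := @mid_conv_small R H H_neg tail_gt0 conv2.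
have JH : exists x1, forall x, x1 <= x -> J x = tail H x.
  have [x1 h1] := JFs; exists (Num.max 0 x1) => x.
  by rewrite ge_max => /andP[x0 x1x]; rewrite HFs// h1.
apply/cvgrPdist_le => e e0.
have [x1 h1] := tail_lower_bound mX a0 hF0 tail_gt0 Jstep JH H_long p_ge p_vanish down_vanish e0.
have [x2 h2] := tail_upper_bound mX a0 hF0 tail_gt0 Jstep J0 Jmon JH H_long H_mid up_vanish e0.
near=> x.
have x0 : 0 <= x by near: x; apply: nbhs_pinfty_ge; exact: num_real.
have x1x : x1 <= x by near: x; apply: nbhs_pinfty_ge; exact: num_real.
have x2x : x2 <= x by near: x; apply: nbhs_pinfty_ge; exact: num_real.
rewrite -/(p x) -HFs// distrC ler_distl.
by rewrite ler_pdivlMr// ler_pdivrMr// h1//= p_le// => N; exact: h2.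
Unshelve. all: by end_near. Qed.
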